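(* Let $n\geq 5$ and let $\pi=(d_1,d_2,\dots,d_n)$ be a graphic sequence with $d_1\geq d_2\geq\cdots\geq d_n\geq 1$. Then $\pi$ is potentially $(K_5-P_4)$-graphic if and only if all of the following hold: (1) $d_2\geq 3$; (2) $d_5\geq 2$; (3) $\pi\neq (n-1,k,2^t,1^{n-2-t})$ for every pair of integers $k,t\in\{3,4,\dots,n-2\}$ such that $k$ and $t$ have different parities; (4) $\pi\neq (n-k,k+i,2^i,1^{n-i-2})$ for every pair of integers $i,k$ with $k\in\{1,2,\dots,\lfloor\frac{n-1}{2}\rfloor-1\}$ and $i\in\{3,4,\dots,n-2k\}$; (5) if $n\in\{6,7\}$, then $\pi\neq(3^2,2^{n-2})$.
   Context: All graphs are finite and simple. A nonincreasing sequence of nonnegative integers is graphic if it is the degree sequence of some simple graph (a realization). A graphic sequence $\pi$ is potentially $H$-graphic if it has a realization containing $H$ as a (not necessarily induced) subgraph. In a sequence, $r^t$ denotes $t$ consecutive terms equal to $r$. $P_4$ denotes the path with $5$ vertices and $4$ edges, and $K_5-P_4$ is the graph obtained from $K_5$ by deleting the edge set of a copy of $P_4$ spanning its 5 vertices (so $K_5-P_4$ has 6 edges and degree sequence $(3,3,2,2,2)$). $\lfloor x\rfloor$ is the largest integer $\leq x$. *)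

(* Defs.v *)
From HB Require Import structures.
From mathcomp Require Import all_boot.

Set Implicit Arguments.
Unset Strict Implicit.
Unset Printing Implicit Defensive.

Record sgraph (T : finType) := SGraph {
  adj :> rel T;
  adj_sym : symmetric adj;
  adj_irr : irreflexive adj
}.

Definition deg (T : finType) (G : sgraph T) (x : T) : nat := #|[set y | G x y]|.

Definition degree_seq (T : finType) (G : sgraph T) : seq nat :=
  sort geq [seq deg G x | x <- enum T].

Definition realization (d : seq nat) (T : finType) (G : sgraph T) : Prop :=
  degree_seq G = d.

Definition graphic (d : seq nat) : Prop :=
  exists (T : finType) (G : sgraph T), realization d G.

(* Not necessarily induced: edges of [H] must be preserved, not reflected. *)
Definition contains (U T : finType) (H : sgraph U) (G : sgraph T) : Prop :=
  exists f : U -> T, injective f /\ (forall x y, H x y -> G (f x) (f y)).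

Definition potentially (U : finType) (H : sgraph U) (d : seq nat) : Prop :=
  exists (T : finType) (G : sgraph T), realization d G /\ contains H G.

Definition complete_rel (n : nat) : rel 'I_n := fun x y => x != y.

Lemma complete_sym n : symmetric (@complete_rel n).
Proof. by move=> x y; rewrite /complete_rel eq_sym. Qed.

Lemma complete_irr n : irreflexive (@complete_rel n).
Proof. by move=> x; rewrite /complete_rel eqxx. Qed.

Definition complete_graph (n : nat) : sgraph 'I_n :=
  SGraph (@complete_sym n) (@complete_irr n).

(* [path_graph m] has [m] edges, hence [m.+1] vertices. *)
Definition path_rel (m : nat) : rel 'I_m.+1 :=
  fun x y => (x.+1 == y :> nat) || (y.+1 == x :> nat).

Lemma path_sym m : symmetric (@path_rel m).
Proof. by move=> x y; rewrite /path_rel orbC. Qed.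

Lemma path_irr m : irreflexive (@path_rel m).
Proof. by move=> x; rewrite /path_rel orbb gtn_eqF. Qed.

Definition path_graph (m : nat) : sgraph 'I_m.+1 :=
  SGraph (@path_sym m) (@path_irr m).

Definition delete_rel (T : finType) (G H : sgraph T) : rel T :=
  fun x y => G x y && ~~ H x y.

Lemma delete_sym (T : finType) (G H : sgraph T) : symmetric (delete_rel G H).
Proof. by move=> x y; rewrite /delete_rel adj_sym (adj_sym H). Qed.

Lemma delete_irr (T : finType) (G H : sgraph T) : irreflexive (delete_rel G H).
Proof. by move=> x; rewrite /delete_rel adj_irr. Qed.

Definition delete_edges (T : finType) (G H : sgraph T) : sgraph T :=
  SGraph (delete_sym G H) (delete_irr G H).

Definition K5_minus_P4 : sgraph 'I_5 :=
  delete_edges (complete_graph 5) (path_graph 4).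

(* Main.v *)
Require Import Defs.
From mathcomp Require Import all_boot zify.
From Stdlib Require Import Classical_Prop.

(* [K5_minus_P4] is the house: a 5-cycle with one chord. If a graph [G] has no
   realization containing a house, then neither has any induced subgraph, because a
   realization of an induced subgraph can be transplanted into [G]. So suppose [G]
   satisfies (1) and (2). Delete vertices of minimum degree one at a time, each after
   Havel-Hakimi switching, for as long as (1) and (2) survive: outside (3,3,2^4),
   (3,3,2^5) and a few sequences treated directly one ends with an induced subgraph of
   degree sequence (4,4,2,2,2) or (5,3,2,2,2,2), a core. A vertex added to a core can
   only see its two vertices of large degree, and this forces the sequence of [G] into
   (4) or (3). Conversely, the house has a cycle edge disjoint from its chord, and the
   excluded sequences leave no room for such an edge. *)

Set Implicit Arguments.
Unset Strict Implicit.
Unset Printing Implicit Defensive.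

(* [lia] on the hypotheses of arithmetic nature only: with large contexts [zify] is slow. *)
Ltac arith :=
  intros; repeat match goal with
  | H : ?P |- _ => lazymatch P with
    | forall _, _ => clear H
    | is_true (uniq _) => clear H
    | is_true (perm_eq _ _) => clear H
    | is_true (in_mem _ _) => clear H
    end
  end; lia.

(** [house_free] speaks of the degree sequence rather than of the graph. Hence it survives
    switching, and the effect of adding one vertex to a fixed sequence becomes a finite search over
    adjacency rows, valid for all graphs with that sequence at once. Deleting a vertex of minimum
    degree can break (1) only by lowering a degree 3 to 2. This is fatal only for (3,3,2^k,1^m),
    where a house is built outright from small cases by adding disjoint triangles and edges, and for
    (e,3,2^k), where the deleted vertex must instead avoid the vertex of degree 3. The core
    (4,4,2,2,2) is the one sequence on five vertices that satisfies (1) and (2) and resists the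
    search; (5,3,2^4) is where (e,3,2^k) has no room left for a deletion. The sequences (3,3,2^4)
    and (3,3,2^5) cannot stop the descent halfway: after adding to either any vertex with a
    neighbour, the new sequence has a realization with a house. *)

Definition dseq (T : finType) (G : sgraph T) (s : seq T) : seq nat :=
  [seq count (G x) s | x <- s].

Definition has_house_realization (d : seq nat) : Prop :=
  exists (T : finType) (G : sgraph T),
    perm_eq (dseq G (enum T)) d /\ contains K5_minus_P4 G.

Lemma deg_count (T : finType) (G : sgraph T) x : deg G x = count (G x) (enum T).
Proof. by rewrite /deg cardsE cardE -size_filter {1}enumT. Qed.

Lemma dseq_enum (T : finType) (G : sgraph T) :
  dseq G (enum T) = [seq deg G x | x <- enum T].
Proof. by apply: eq_map => x; rewrite deg_count. Qed.

Lemma perm_dseq (T : finType) (G : sgraph T) s t :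
  perm_eq s t -> perm_eq (dseq G s) (dseq G t).
Proof.
move=> st; rewrite /dseq (eq_map (g := fun x => count (G x) t)); first exact: perm_map.
by move=> x; apply/permP.
Qed.

(** Serves to name vertices: a degree sequence known up to order becomes an ordering of the vertices
    that carries exactly these degrees. *)
Lemma perm_map_preim (T : eqType) (f : T -> nat) s d :
  perm_eq (map f s) d -> exists2 t, perm_eq s t & map f t = d.
Proof.
elim: d s => [|y d IH] s sd.
  by exists [::] => //; move/perm_nilP: sd; case: s.
have /mapP [x xs yE] : y \in map f s by rewrite (perm_mem sd) mem_head.
have sx := perm_to_rem xs.
have : perm_eq (map f (rem x s)) d.
  by rewrite -(perm_cons y) -(permPr sd) perm_sym {1}yE -map_cons perm_map.
case/IH => t st <-; exists (x :: t); last by rewrite /= yE.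
by apply: perm_trans sx _; rewrite perm_cons.
Qed.

Lemma has_house_perm d d' :
  perm_eq d d' -> has_house_realization d -> has_house_realization d'.
Proof. by move=> dd' [T [G [Gd Gh]]]; exists T, G; rewrite -(permPr dd'). Qed.

(* The chord is 01, its common neighbour is 2. *)
Definition house_edges := [:: (0, 1); (0, 2); (1, 2); (0, 3); (1, 4); (3, 4)].

(** * Certified search for realizations that contain a house *)

Definition edge_rel (es : seq (nat * nat)) : rel nat :=
  fun x y => (x != y) && (((x, y) \in es) || ((y, x) \in es)).

(* Backtracking search for a graph with edges among [ps] and degrees [res]. Nothing is
   proved about it: [house_completion] checks its answer. *)
Fixpoint complete_edges (ps : seq (nat * nat)) (res : seq nat) :
    option (seq (nat * nat)) :=
  if ps is (i, j) :: ps' then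
    if ~~ all (pred1 0) (take i res) then None else
    let skip := complete_edges ps' in
    if (0 < nth 0 res i) && (0 < nth 0 res j) then
      if complete_edges ps'
          (set_nth 0 (set_nth 0 res i (nth 0 res i).-1) j (nth 0 res j).-1)
        is Some es then Some ((i, j) :: es) else skip res
    else skip res
  else if all (pred1 0) res then Some [::] else None.

(** The constants are the degrees of [house_edges]. Truncated subtraction is harmless: the final
    comparison with [d] rejects a sequence that lies below them. *)
Definition house_residue (d : seq nat) : seq nat :=
  [seq p.1 - p.2 | p <- zip d ([:: 3; 3; 2; 2; 2] ++ nseq (size d) 0)].

Definition free_pairs (n : nat) : seq (nat * nat) :=
  [seq p <- [seq (i, j) | i <- iota 0 n, j <- iota 0 n] |
    (p.1 < p.2) && (p \notin house_edges)].

Definition house_completion (d : seq nat) : bool :=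
  let n := size d in
  if complete_edges (free_pairs n) (house_residue d) is Some es then
    (4 < n) && ([seq count (edge_rel (house_edges ++ es) x) (iota 0 n)
                | x <- iota 0 n] == d) else false.

(* The chord may be put on two vertices of largest degree, but which of the next three
   is opposite to it matters. *)
Definition house_test (d : seq nat) : bool :=
  if sort geq d is d1 :: d2 :: d3 :: d4 :: d5 :: d' then
    has (fun p => house_completion [:: d1, d2 & p ++ d']) (permutations [:: d3; d4; d5])
  else false.


Definition edges_rel n es : rel 'I_n := fun x y => edge_rel es x y.

Lemma edges_sym n es : symmetric (@edges_rel n es).
Proof. by move=> x y; rewrite /edges_rel /edge_rel eq_sym orbC. Qed.

Lemma edges_irr n es : irreflexive (@edges_rel n es).
Proof. by move=> x; rewrite /edges_rel /edge_rel eqxx. Qed.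

Definition edges_graph n es : sgraph 'I_n := SGraph (@edges_sym n es) (@edges_irr n es).

Lemma dseq_edges_graph n es :
  dseq (edges_graph n es) (enum 'I_n) = [seq count (edge_rel es x) (iota 0 n) | x <- iota 0 n].
Proof.
rewrite -val_enum_ord -map_comp; apply: eq_map => x.
by rewrite /= count_map; apply: eq_count.
Qed.

Lemma house_completion_sound d : house_completion d -> has_house_realization d.
Proof.
rewrite /house_completion; set n := size d.
case: complete_edges => // es /andP [n4 /eqP dE].
exists 'I_n, (edges_graph n (house_edges ++ es)); split.
  by rewrite dseq_edges_graph dE.
(* The list is an isomorphism from the complement of the path 0-1-2-3-4 to [house_edges]: the path
   ends 0 and 4 go to the chord, the midpoint 2 to its common neighbour. *)
have pos_lt (x : 'I_5) : nth 0 [:: 0; 4; 2; 3; 1] x < n.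
  by apply: leq_trans n4; case: x => [[|[|[|[|[|]]]]]].
exists (fun x => Ordinal (pos_lt x)); split.
  move=> x y /(congr1 val) /= xy; apply/val_inj.
  by move: x y xy => [[|[|[|[|[|?]]]]] ?] [[|[|[|[|[|?]]]]] ?].
move=> x y xy; rewrite /= /edges_rel /edge_rel /=; move: xy.
by move: x y => [[|[|[|[|[|?]]]]] ?] [[|[|[|[|[|?]]]]] ?] //= _; rewrite !inE /= orbT.
Qed.

Lemma house_test_sound d : house_test d -> has_house_realization d.
Proof.
rewrite /house_test; have: perm_eq (sort geq d) d by rewrite perm_sort.
case: sort => [|d1 [|d2 [|d3 [|d4 [|d5 d']]]]] //= dE /hasP [p].
rewrite mem_permutations => pE /house_completion_sound; apply: has_house_perm.
apply: perm_trans dE; rewrite !perm_cons.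
by rewrite -[_ :: _]/([:: d3; d4; d5] ++ d') perm_cat2r.
Qed.

(** * Rewiring inside a vertex set, and transplantation *)

(** Fixing all pairs that leave [s] makes a rewiring found in an induced subgraph also a rewiring of
    every larger induced subgraph, with the same degrees there. *)
Definition switch_equiv (T : finType) (s : seq T) (G G' : sgraph T) : Prop :=
  (forall a b, ~~ ((a \in s) && (b \in s)) -> G' a b = G a b) /\
  (forall a, a \in s -> count (G' a) s = count (G a) s).

Lemma switch_equiv_refl (T : finType) (s : seq T) G : switch_equiv s G G.
Proof. by []. Qed.

Lemma switch_equiv_trans (T : finType) (s : seq T) G1 G2 G3 :
  switch_equiv s G1 G2 -> switch_equiv s G2 G3 -> switch_equiv s G1 G3.
Proof.
move=> [o12 i12] [o23 i23]; split=> [a b ab|a sa]; first by rewrite o23 ?o12.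
by rewrite i23 ?i12.
Qed.

Lemma switch_equiv_sub (T : finType) (s s' : seq T) G G' :
    uniq s -> uniq s' -> {subset s <= s'} ->
  switch_equiv s G G' -> switch_equiv s' G G'.
Proof.
move=> us us' ss' [out ins]; split=> [a b ab|a as'].
  by apply: out; apply: contra ab => /andP [/ss' -> /ss' ->].
have split_count H : count (adj H a) s' = count (H a) s + count (H a) [seq x <- s' | x \notin s].
  rewrite -count_cat; apply/permP; apply: uniq_perm => //.
    rewrite cat_uniq us filter_uniq // andbT.
    by apply/hasPn => x; rewrite mem_filter => /andP [].
  by move=> x; rewrite mem_cat mem_filter; case: (boolP (x \in s)) => //= /ss'.
rewrite !split_count; congr (_ + _); last first.
  by apply: eq_in_count => x; rewrite mem_filter => /andP [xs _]; rewrite out // negb_and xs orbT.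
case: (boolP (a \in s)) => [/ins //|ans].
by apply: eq_count => x; rewrite out // (negPf ans).
Qed.

Lemma switch_equiv_dseq (T : finType) (s : seq T) G G' :
  switch_equiv s G G' -> dseq G' s = dseq G s.
Proof. by move=> [_ ins]; apply/eq_in_map. Qed.

Section Transplant.
Variables (T U : finType) (G : sgraph T) (K : sgraph U) (s : seq T).
Variables (g : U -> T).
Hypotheses (g_inj : injective g) (g_im : perm_eq (map g (enum U)) s).
Hypothesis g_deg : forall a, count (G (g a)) s = deg K a.

Definition transplant_rel : rel T := fun x y =>
  if (x \in s) && (y \in s) then
    [exists a, [exists b, [&& g a == x, g b == y & K a b]]]
  else G x y.

Lemma transplant_sym : symmetric transplant_rel.
Proof.
move=> x y; rewrite /transplant_rel andbC adj_sym; case: ifP => // _.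
by apply/existsP/existsP => -[a /existsP [b /and3P [ax bx ab]]];
  exists b; apply/existsP; exists a; rewrite ax bx adj_sym ab.
Qed.

Lemma transplant_irr : irreflexive transplant_rel.
Proof.
move=> x; rewrite /transplant_rel adj_irr; case: ifP => // _.
apply/negbTE/existsP => -[a /existsP [b /and3P [/eqP <- /eqP /g_inj ->]]].
by rewrite adj_irr.
Qed.

Definition transplant : sgraph T := SGraph transplant_sym transplant_irr.

Lemma mem_transplant a : g a \in s.
Proof. by rewrite -(perm_mem g_im) map_f // mem_enum. Qed.

Lemma transplantE a b : transplant (g a) (g b) = K a b.
Proof.
rewrite /= /transplant_rel !mem_transplant /=.
apply/existsP/idP => [[a' /existsP [b' /and3P [/eqP/g_inj <- /eqP/g_inj <-]]] //|ab].
by exists a; apply/existsP; exists b; rewrite !eqxx.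
Qed.

Lemma transplant_equiv : switch_equiv s G transplant.
Proof.
split=> [a b /negbTE ab|x]; first by rewrite /= /transplant_rel ab.
rewrite -(perm_mem g_im) => /mapP [a _ ->].
rewrite g_deg deg_count -(permP g_im) count_map; apply: eq_count => b.
by rewrite /= -transplantE.
Qed.

End Transplant.

(** Equal degree sequences give a bijection from [U] to [s] that matches degrees. Carrying [K]
    across it changes only pairs inside [s] and no degree. *)
Lemma transplant_exists (T U : finType) (x0 : T) (G : sgraph T) (K : sgraph U) s :
    uniq s -> perm_eq (dseq K (enum U)) (dseq G s) ->
  exists (G' : sgraph T) (g : U -> T), [/\ switch_equiv s G G', injective g,
    forall a, g a \in s & forall a b, G' (g a) (g b) = K a b].
Proof.
move=> us /perm_map_preim [u pu mapu].
have szu : size u = size s by rewrite -[LHS](size_map (fun x => count (K x) (enum U))) mapu size_map.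
have uu : uniq u by rewrite -(perm_uniq pu) enum_uniq.
have mu a : a \in u by rewrite -(perm_mem pu) mem_enum.
have iu a : index a u < size s by rewrite -szu index_mem.
pose g a := nth x0 s (index a u).
have gi : injective g.
  move=> a b /eqP; rewrite nth_uniq // => /eqP ab.
  by rewrite -[a](nth_index a (mu a)) ab nth_index.
have gm : perm_eq (map g (enum U)) s.
  apply: (perm_trans (perm_map g pu)).
  suff -> : map g u = s by [].
  apply: (@eq_from_nth _ x0) => [|i]; rewrite size_map // => iu'.
  have a : U by move: iu'; case: (u).
  by rewrite (nth_map a) // /g index_uniq.
have gd a : count (G (g a)) s = deg K a.
  rewrite deg_count -[in RHS](nth_index a (mu a)).
  rewrite -(nth_map a 0 (fun b => count (K b) (enum U))) ?szu // mapu.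
  by rewrite (nth_map x0).
exists (transplant G K s gi), g; split=> //.
- exact: transplant_equiv.
- exact: mem_transplant.
- exact: transplantE.
Qed.

(** Stronger than the absence of a house in [G] itself: no graph with the same degrees may contain
    one. *)
Definition house_free (T : finType) (G : sgraph T) : Prop :=
  ~ has_house_realization (dseq G (enum T)).

Lemma switch_equiv_house_free (T : finType) (s : seq T) G G' :
  uniq s -> switch_equiv s G G' -> house_free G -> house_free G'.
Proof.
move=> us eG; rewrite /house_free (switch_equiv_dseq (s := enum T) (G := G)) //.
by apply: switch_equiv_sub eG; rewrite ?enum_uniq // => x _; rewrite mem_enum.
Qed.

Lemma house_free_sub (T : finType) (G : sgraph T) s :
  house_free G -> uniq s -> ~ has_house_realization (dseq G s).
Proof.
move=> hG us [U [K [Kd [f [fi fK]]]]].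
case: s us Kd => [|x0 s] us Kd.
  have := perm_size Kd; rewrite size_map -cardE /= => /card0_eq /(_ (f ord0)).
  by rewrite inE.
have [G' [g [eG gi _ gK]]] := transplant_exists x0 us Kd.
apply: (switch_equiv_house_free us eG hG); exists T, G'; split=> //.
exists (g \o f); split; first exact: inj_comp.
by move=> x y xy; rewrite /= gK fK.
Qed.

Lemma house_free_test (T : finType) (G : sgraph T) s :
  house_free G -> uniq s -> house_test (dseq G s) = false.
Proof. by move=> hG us; apply/negP => /house_test_sound; apply: house_free_sub. Qed.

(** * Degree sequences after adding a vertex *)

Fixpoint bits n : seq (seq bool) := if n is n'.+1 then
  [seq b :: l | b <- [:: false; true], l <- bits n'] else [:: [::]].

Lemma mem_bits b : b \in bits (size b).
Proof.
elim: b => [|x b IH] //=; rewrite !mem_cat /=.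
by case: x; rewrite (map_f (cons _) IH) ?orbT.
Qed.

(* The degrees after adding a vertex whose adjacency row is [b]. *)
Definition extend_dseq (d : seq nat) (b : seq bool) : seq nat :=
  sumn (map nat_of_bool b) :: [seq p.1 + nat_of_bool p.2 | p <- zip d b].

Lemma dseq_cons (T : finType) (G : sgraph T) r s :
  dseq G (r :: s) = extend_dseq (dseq G s) [seq G r x | x <- s].
Proof.
rewrite /extend_dseq /dseq /= adj_irr add0n; congr (_ :: _).
  by elim: s => //= x s ->.
rewrite zip_map -map_comp; apply: eq_map => x /=.
by rewrite addnC [G x r]adj_sym.
Qed.

Lemma perm_cat_sub (T : eqType) (t s : seq T) :
  uniq t -> uniq s -> {subset t <= s} ->
  perm_eq s (t ++ [seq x <- s | x \notin t]).
Proof.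
move=> ut us ts; apply: uniq_perm => //.
  rewrite cat_uniq ut filter_uniq // andbT.
  by apply/hasPn => x; rewrite mem_filter => /andP [].
by move=> x; rewrite mem_cat mem_filter; case: (boolP (x \in t)) => //= /ts.
Qed.

(** * Switching and the Havel-Hakimi argument *)

Lemma count_exchange (T : eqType) (s : seq T) (p q : pred T) u w :
    uniq s -> u \in s -> w \in s -> u != w ->
    (forall z, z != u -> z != w -> p z = q z) -> p u + p w = q u + q w ->
  count p s = count q s.
Proof.
move=> us su sw uw pq uwE.
have /permP sE : perm_eq s ([:: u; w] ++ [seq x <- s | x \notin [:: u; w]]).
  apply: perm_cat_sub => //=; first by rewrite inE uw.
  by move=> x; rewrite !inE => /orP [] /eqP ->.
rewrite !sE /= !addnA uwE; congr (_ + _); apply: eq_in_count => x.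
by rewrite mem_filter !inE negb_or => /andP [/andP [xu xw] _]; rewrite pq.
Qed.

Section Switch.
Variables (T : finType) (G : sgraph T) (s : seq T) (x u w y : T).
Hypotheses (us : uniq s) (xs : x \in s) (u_s : u \in s) (ws : w \in s) (ys : y \in s).
Hypotheses (xu : G x u) (wy : G w y) (xw : ~~ G x w) (uy : ~~ G u y).
Hypotheses (x_w : x != w) (u_y : u != y).

Definition same_pair (p q a b : T) : bool :=
  (a == p) && (b == q) || (a == q) && (b == p).

(** The classical 2-switch: the edges [x u] and [w y] are traded for [x w] and [u y]. *)
Definition switch_rel : rel T := fun a b =>
  if same_pair x u a b || same_pair w y a b then false
  else same_pair x w a b || same_pair u y a b || G a b.

Lemma same_pairC p q a b : same_pair p q a b = same_pair p q b a.
Proof. by rewrite /same_pair orbC ![(a == _) && _]andbC. Qed.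

Lemma switch_sym : symmetric switch_rel.
Proof.
by move=> a b; rewrite /switch_rel adj_sym !(same_pairC _ _ a b).
Qed.

Lemma same_pair_diag p q a : p != q -> same_pair p q a a = false.
Proof.
by move=> pq; rewrite /same_pair; have [->|] := eqVneq a p; rewrite ?(negbTE pq) ?andbF.
Qed.

Lemma switch_irr : irreflexive switch_rel.
Proof.
by move=> a; rewrite /switch_rel adj_irr !(same_pair_diag _ x_w) !(same_pair_diag _ u_y); case: ifP.
Qed.

Definition switch : sgraph T := SGraph switch_sym switch_irr.

Lemma switch_distinct : [/\ x != u, w != y, u != w & x != y].
Proof.
split.
- by apply: contraTneq xu => ->; rewrite adj_irr.
- by apply: contraTneq wy => ->; rewrite adj_irr.
- by apply: contraTneq xu => ->.
- by apply: contraTneq wy => <-; rewrite adj_sym.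
Qed.

Lemma switch_equivP : switch_equiv s G switch.
Proof.
have [x_u w_y u_w x_y] := switch_distinct.
have [u_x y_w w_u y_x] : [/\ u != x, y != w, w != u & y != x].
  by split; rewrite eq_sym.
have [w_x y_u] : w != x /\ y != u by split; rewrite eq_sym.
have [ux yw wx yu] : [/\ G u x, G y w, ~~ G w x & ~~ G y u].
  by split; rewrite adj_sym.
split=> [a b ab|a _].
  rewrite /= /switch_rel.
  have off p q : p \in s -> q \in s -> same_pair p q a b = false.
    move=> ps qs; apply: contraNF ab.
    by case/orP => /andP [/eqP -> /eqP ->]; rewrite ps qs.
  by rewrite !off.
have simp := (negbTE x_u, negbTE w_y, negbTE u_w, negbTE x_y, negbTE u_x, negbTE y_w,
  negbTE w_u, negbTE y_x, negbTE w_x, negbTE y_u, negbTE x_w, negbTE u_y, eqxx).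
have [->|ax] := eqVneq a x.
  apply: (@count_exchange _ _ _ _ u w) => // [z zu zw|];
    rewrite /= /switch_rel /same_pair !simp.
    by rewrite (negbTE zu) (negbTE zw).
  by rewrite /= xu (negbTE xw).
have [->|aw] := eqVneq a w.
  apply: (@count_exchange _ _ _ _ x y) => // [z zu zw|];
    rewrite /= /switch_rel /same_pair !simp.
    by rewrite (negbTE zu) (negbTE zw).
  by rewrite /= wy (negbTE wx).
have [->|au] := eqVneq a u.
  apply: (@count_exchange _ _ _ _ x y) => // [z zu zw|];
    rewrite /= /switch_rel /same_pair !simp.
    by rewrite (negbTE zu) (negbTE zw).
  by rewrite /= ux (negbTE uy).
have [->|ay] := eqVneq a y.
  apply: (@count_exchange _ _ _ _ u w) => // [z zu zw|];
    rewrite /= /switch_rel /same_pair !simp.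
    by rewrite (negbTE zu) (negbTE zw).
  by rewrite /= yw (negbTE yu).
by apply: eq_count => z; rewrite /= /switch_rel /same_pair (negbTE ax) (negbTE aw) (negbTE au) (negbTE ay).
Qed.

End Switch.

(** The vertex [x] counts for [u] and not for [w], so the surplus of [w] must come from a further
    vertex. *)
Lemma switch_partner (T : finType) (G : sgraph T) s x u w :
    uniq s -> x \in s -> u \in s -> w \in s -> x != w -> G x u -> ~~ G x w ->
    count (G u) s < count (G w) s ->
  exists y, [/\ y \in s, G w y, ~~ G u y & u != y].
Proof.
move=> us xs us' ws xw Gxu Gxw uw.
have x_u : x != u by apply: contraTneq Gxu => ->; rewrite adj_irr.
have u_w : u != w by apply: contraTneq Gxu => ->.
pose r := [seq y <- s | y \notin [:: u; w; x]].
have /permP sE : perm_eq s ([:: u; w; x] ++ r).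
  apply: perm_cat_sub => //=.
    by rewrite !inE negb_or u_w eq_sym x_u eq_sym xw.
  by move=> y; rewrite !inE => /or3P [] /eqP ->.
have : has (fun y => G w y && ~~ G u y) r.
  apply: contraLR uw => /hasPn H; rewrite -leqNgt !sE /= !adj_irr.
  rewrite [G u x]adj_sym Gxu [G w x]adj_sym (negbTE Gxw) [G w u]adj_sym.
  clear sE; have : count (G w) r <= count (G u) r.
    rewrite -!size_filter; apply: uniq_leq_size; first by rewrite !filter_uniq.
    move=> y; rewrite !(mem_filter _ y r) => /andP [wy yr]; rewrite yr andbT.
    by have := H y yr; rewrite wy negbK.
  by lia.
case/hasP => y; rewrite mem_filter !inE !negb_or => /andP [/and3P [yu _ _] ys] /andP [wy uy].
by exists y; rewrite eq_sym.
Qed.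

(* Havel-Hakimi: switching can only increase the total degree of the neighbours of [x]. *)
Lemma havel_hakimi (T : finType) (G : sgraph T) s x :
    uniq s -> x \in s ->
  exists2 G' : sgraph T, switch_equiv s G G' &
    forall u w, u \in s -> w \in s -> x != w -> G' x u -> ~~ G' x w ->
      count (G' w) s <= count (G' u) s.
Proof.
move=> us xs.
pose weight (H : sgraph T) := \sum_(u <- s) H x u * count (H u) s.
pose bound := \sum_(u <- s) count (G u) s.
(* Each switch raises the weight by the positive difference of the two degrees, while its bound, the
   total degree inside [s], stays fixed. *)
have [k] := ubnP (bound - weight G); rewrite {}/bound.
elim: k G => // k IH G ltk.
have bad : pred2 true false (has (fun u => has (fun w => [&& x != w, G x u, ~~ G x w
  & count (G u) s < count (G w) s]) s) s) by case: has.
case/orP: bad => /eqP; last first.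
  move/negbT/hasPn => H; exists G; first exact: switch_equiv_refl.
  move=> u w su sw xw Gxu Gxw; have /hasPn /(_ w sw) := H u su.
  by rewrite xw Gxu Gxw -leqNgt.
case/hasP => u su /hasP [w sw /and4P [xw Gxu Gxw uw]].
have [y [ys wy uy u_y]] := switch_partner us xs su sw xw Gxu Gxw uw.
have eG := switch_equivP us xs su sw ys Gxu wy Gxw uy xw u_y.
have [x_u w_y u_w x_y] := switch_distinct Gxu wy Gxw.
set G1 := switch G xw u_y in eG.
have d1 z : z \in s -> count (G1 z) s = count (G z) s by case: eG => _; apply.
have sE0 : perm_eq s ([:: u; w] ++ [seq z <- s | z \notin [:: u; w]]).
  apply: perm_cat_sub => //=; first by rewrite inE u_w.
  by move=> z; rewrite !inE => /orP [] /eqP ->.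
have sE F : \sum_(z <- s) F z = \sum_(z <- [:: u; w] ++ [seq z <- s | z \notin [:: u; w]]) F z.
  exact: perm_big.
have [G1xu G1xw] : G1 x u = false /\ G1 x w.
  rewrite /= /switch_rel /same_pair !eqxx [w == u]eq_sym.
  by rewrite (negbTE xw) (negbTE x_y) (negbTE u_w) (negbTE x_u).
have G1x z : z != u -> z != w -> G1 x z = G x z.
  move=> zu zw; rewrite /= /switch_rel /same_pair (negbTE zu) (negbTE zw).
  by rewrite (negbTE xw) (negbTE x_u) (negbTE x_y) !andbF.
clearbody G1.
have wE : weight G1 + count (G u) s = weight G + count (G w) s.
  rewrite /weight !sE !big_cat !big_cons !big_nil /= !d1 // G1xu G1xw Gxu (negbTE Gxw).
  set S1 := \sum_(z <- _) _; set S2 := \sum_(z <- _) _.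
  have -> : S1 = S2; last first.
    by move: (count (G u) s) (count (G w) s) S2 => a b c; clear; rewrite /nat_of_bool; lia.
  apply: eq_big_seq => z; rewrite mem_filter !inE negb_or => /andP [/andP [zu zw] zs].
  by rewrite G1x // d1.
have sumE : \sum_(z <- s) count (G1 z) s = \sum_(z <- s) count (G z) s.
  by apply: eq_big_seq.
have w_bound : weight G1 <= \sum_(z <- s) count (G1 z) s.
  by apply: leq_sum => z _; case: (G1 x z); rewrite ?mul1n.
have [|G' eG' HG'] := IH G1; first by clear -ltk uw wE sumE w_bound; rewrite sumE in w_bound *; lia.
by exists G' => //; apply: switch_equiv_trans eG eG'.
Qed.

(** * Disjoint unions and the sequences (3,3,2^k,1^m) *)

Section DisjointUnion.
Variables (T U : finType) (G : sgraph T) (H : sgraph U).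

Definition union_rel : rel (T + U)%type := fun a b =>
  match a, b with inl x, inl y => G x y | inr x, inr y => H x y | _, _ => false end.

Lemma union_sym : symmetric union_rel.
Proof. by move=> [x|x] [y|y] //=; rewrite adj_sym. Qed.

Lemma union_irr : irreflexive union_rel.
Proof. by move=> [x|x] /=; rewrite adj_irr. Qed.

Definition union : sgraph (T + U)%type := SGraph union_sym union_irr.

Lemma dseq_union :
  perm_eq (dseq union (enum {: T + U})) (dseq G (enum T) ++ dseq H (enum U)).
Proof.
have sE : perm_eq (enum {: T + U}) (map inl (enum T) ++ map inr (enum U)).
  apply: uniq_perm; rewrite ?enum_uniq //.
    have inl_inj : injective (@inl T U) by move=> x y [].
    have inr_inj : injective (@inr T U) by move=> x y [].
    rewrite cat_uniq (map_inj_uniq inl_inj) (map_inj_uniq inr_inj) !enum_uniq andbT.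
    apply/hasPn => _ /mapP [x _ ->].
    by apply/negP => /mapP [y _].
  move=> [x|x]; rewrite mem_enum inE mem_cat.
    by rewrite map_f ?mem_enum.
  by rewrite orbC map_f ?mem_enum.
rewrite (permPl (perm_dseq _ sE)) /dseq map_cat -[map _ (map inl _)]map_comp -[map _ (map inr _)]map_comp.
have inlE x : count (union (inl x)) (map inl (enum T) ++ map inr (enum U)) = count (G x) (enum T).
  rewrite count_cat !count_map /= [X in _ + X](eq_count (a2 := pred0)) // count_pred0 addn0.
  exact: eq_count.
have inrE x : count (union (inr x)) (map inl (enum T) ++ map inr (enum U)) = count (H x) (enum U).
  rewrite count_cat !count_map /= [X in X + _](eq_count (a2 := pred0)) // count_pred0.
  exact: eq_count.
by rewrite -(eq_map inlE) -(eq_map inrE).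
Qed.

End DisjointUnion.

Lemma has_house_cat d (U : finType) (H : sgraph U) :
  has_house_realization d -> has_house_realization (dseq H (enum U) ++ d).
Proof.
move=> [T [G [Gd [f [fi fG]]]]]; exists (T + U)%type, (union G H); split.
  by rewrite (permPl (dseq_union G H)) perm_catC perm_cat2l.
by exists (inl \o f); split=> [|x y xy]; [apply: inj_comp fi => x y [] | apply: fG].
Qed.

Lemma has_house_edge d : has_house_realization d -> has_house_realization [:: 1, 1 & d].
Proof.
move/(has_house_cat (edges_graph 2 [:: (0, 1)])).
by rewrite dseq_edges_graph.
Qed.

Lemma has_house_triangle d :
  has_house_realization d -> has_house_realization [:: 2, 2, 2 & d].
Proof.
move/(has_house_cat (edges_graph 3 [:: (0, 1); (0, 2); (1, 2)])).
by rewrite dseq_edges_graph.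
Qed.

Lemma has_house_33_2 k :
  3 <= k -> k != 4 -> k != 5 -> has_house_realization ([:: 3; 3] ++ nseq k 2).
Proof.
have [n] := ubnP k; elim: n k => // n IH k ltk k3 k4 k5.
have [k8|k8] := leqP k 8.
  (* Subtracting 3 from [k >= 9] never lands on the forbidden lengths 4 and 5, so these four cases
     suffice. *)
  have : k \in [:: 3; 6; 7; 8] by rewrite !inE; lia.
  rewrite !inE => /or4P [] /eqP ->; apply: house_test_sound; by vm_compute.
have /has_house_triangle : has_house_realization ([:: 3; 3] ++ nseq (k - 3) 2).
  by apply: IH; lia.
apply: has_house_perm; apply/permP => p /=.
by rewrite !count_nseq; case: (p 2); rewrite ?mul1n ?mul0n; lia.
Qed.

Lemma has_house_33_2_1 k m :
    3 <= k -> ~~ odd m -> (m == 0) ==> (k != 4) && (k != 5) ->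
  has_house_realization ([:: 3; 3] ++ nseq k 2 ++ nseq m 1).
Proof.
have [n] := ubnP m; elim: n m => // n IH [|[|m]] ltm k3 // om km.
  by rewrite cats0; case/andP: km => k4 k5; apply: has_house_33_2.
(* Stripping the last pair of ones would leave (3,3,2^4) or (3,3,2^5), so these two sequences with
   [1, 1] appended are settled by search. *)
have [/andP [/eqP m0 k45]|km'] := boolP ((m == 0) && ((k == 4) || (k == 5))).
  by rewrite m0; case/orP: k45 => /eqP ->; apply: house_test_sound; vm_compute.
have /has_house_edge : has_house_realization ([:: 3; 3] ++ nseq k 2 ++ nseq m 1).
  apply: IH => //; first by lia.
  - by move: om; rewrite /= negbK.
  - by move: km'; case: (m == 0); rewrite //= negb_or.
apply: has_house_perm; apply/permP => p /=.
by rewrite !count_cat /= !count_nseq; case: (p 1); rewrite ?mul1n ?mul0n /=; lia.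
Qed.

Lemma perm_eq_12 d : all (fun x => 0 < x <= 2) d ->
  perm_eq d (nseq (count_mem 2 d) 2 ++ nseq (count_mem 1 d) 1).
Proof.
move=> d12; apply/permP => p; rewrite count_cat !count_nseq.
elim: d d12 => [|x d IH] /=; first by rewrite !muln0.
case/andP => x12 /IH ->; have /orP [/eqP -> | /eqP ->] : (x == 1) || (x == 2) by lia.
  by rewrite /= mulnDr; case: (p 1); lia.
by rewrite /= mulnDr; case: (p 2); lia.
Qed.

(** Handshake lemma: a new vertex adds its row sum twice, once as its own degree and once spread
    over its neighbours. *)
Lemma sumn_dseq_even (T : finType) (G : sgraph T) s : ~~ odd (sumn (dseq G s)).
Proof.
elim: s => // r s IH; rewrite dseq_cons /extend_dseq /=.
suff -> : forall (d : seq nat) b, size d = size b ->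
    sumn [seq p.1 + nat_of_bool p.2 | p <- zip d b] = sumn d + sumn (map nat_of_bool b).
  by rewrite addnCA addnn oddD odd_double addbF.
  by rewrite !size_map.
by elim=> [|x d IHd] [|y b] //= [/IHd ->]; lia.
Qed.

Lemma dseq_perm_preim (T : finType) (G : sgraph T) t d :
  perm_eq (dseq G t) d -> exists2 t', perm_eq t t' & dseq G t' = d.
Proof.
case/perm_map_preim => t' tt' <-; exists t' => //.
by apply: eq_map => x; apply/permP; rewrite perm_sym.
Qed.

(** Only rows with a neighbour are tested. This keeps (3,3,2^4) and (3,3,2^5) from appearing as
    proper induced subgraphs during the descent. *)
Lemma house_free_extension (T : finType) (G : sgraph T) d x t :
    all (fun b => has id b ==> house_test (extend_dseq d b)) (bits (size d)) ->
    house_free G -> uniq (x :: t) -> 0 < count (G x) t ->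
  ~ perm_eq (dseq G t) d.
Proof.
move=> /allP dtest hG uxt xt /dseq_perm_preim [t' tt' t'E].
have uxt' : uniq (x :: t') by rewrite -(perm_uniq (s1 := x :: t)) // perm_cons.
have := house_free_test hG uxt'; rewrite dseq_cons t'E.
move/negbT/negP; apply; set b := map _ _.
have sb : size b = size d by rewrite size_map -t'E size_map.
apply: (implyP (dtest b _)); first by rewrite -sb mem_bits.
by rewrite has_map -(perm_has _ tt') has_count.
Qed.

Lemma dseq_33_12 (T : finType) (G : sgraph T) s e :
    house_free G -> uniq s -> perm_eq (dseq G s) [:: 3, 3 & e] ->
    all (fun x => 0 < x <= 2) e -> 3 <= count (leq 2) e ->
  perm_eq (dseq G s) [:: 3; 3; 2; 2; 2; 2] \/ perm_eq (dseq G s) [:: 3; 3; 2; 2; 2; 2; 2].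
Proof.
move=> hG us sE e12 e2; have eE := perm_eq_12 e12.
set k := count_mem 2 e in eE; set m := count_mem 1 e in eE.
have {e2} k3 : 3 <= k.
  by move: e2; rewrite (permP eE) count_cat !count_nseq /= mul1n mul0n addn0.
have {}sE : perm_eq (dseq G s) ([:: 3; 3] ++ nseq k 2 ++ nseq m 1).
  by rewrite (permPl sE) !perm_cons.
have om : ~~ odd m.
  have := sumn_dseq_even G s; rewrite (perm_sumn sE) !sumn_cat !sumn_nseq.
  by rewrite mul2n mul1n !oddD odd_double.
have [/andP [/eqP m0 /orP [] /eqP kE]|km] := boolP ((m == 0) && ((k == 4) || (k == 5))).
- by left; rewrite m0 kE in sE.
- by right; rewrite m0 kE in sE.
case: (house_free_sub hG us); apply: has_house_perm (has_house_33_2_1 k3 om _).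
  by rewrite perm_sym.
by move: km; case: (m == 0); rewrite //= negb_or.
Qed.

(** * Descent to a core *)

Definition has_core (T : finType) (G : sgraph T) (s : seq T) : Prop :=
  exists (G' : sgraph T) t, [/\ switch_equiv s G G', uniq t, {subset t <= s} &
    perm_eq (dseq G' t) [:: 4; 4; 2; 2; 2] \/ perm_eq (dseq G' t) [:: 5; 3; 2; 2; 2; 2]].

Lemma has_core_sub (T : finType) (G G' : sgraph T) s s' :
    uniq s -> uniq s' -> {subset s' <= s} -> switch_equiv s G G' ->
  has_core G' s' -> has_core G s.
Proof.
move=> us us' ss' eG [G'' [t [eG' ut ts' tE]]]; exists G'', t; split=> //.
  exact: switch_equiv_trans eG (switch_equiv_sub us' us ss' eG').
by move=> x /ts' /ss'.
Qed.

Fixpoint all_dseqs n : seq (seq nat) := if n is n'.+1 then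
  [seq extend_dseq d b | d <- all_dseqs n', b <- bits n'] else [:: [::]].

Lemma mem_all_dseqs (T : finType) (G : sgraph T) s : dseq G s \in all_dseqs (size s).
Proof.
elim: s => // x s IH; rewrite dseq_cons /=; apply: allpairs_f => //.
by rewrite -(size_map (G x)) mem_bits.
Qed.

(** Exhaustion of the 1024 labelled graphs on five vertices; this is where the core (4,4,2,2,2)
    comes from. *)
Lemma core5 (T : finType) (G : sgraph T) s :
    house_free G -> uniq s -> size s = 5 ->
    2 <= count (leq 3) (dseq G s) -> 5 <= count (leq 2) (dseq G s) ->
  has_core G s.
Proof.
move=> hG us s5 c3 c2; exists G, s; split=> //; left.
have /allP test : all (fun d => (1 < count (leq 3) d) && (4 < count (leq 2) d) ==>
  house_test d || perm_eq d [:: 4; 4; 2; 2; 2]) (all_dseqs 5) by vm_compute.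
have /test : dseq G s \in all_dseqs 5 by rewrite -s5 mem_all_dseqs.
by rewrite c3 c2 house_free_test.
Qed.

(* Conditions (1) and (2) of the theorem for the subgraph induced on [s]. *)
Definition rich (T : finType) (G : sgraph T) (s : seq T) : Prop :=
  [/\ all (fun y => 0 < count (G y) s) s, 2 <= count (fun y => 2 < count (G y) s) s
    & 5 <= count (fun y => 1 < count (G y) s) s].

Definition small_exception (d : seq nat) : Prop :=
  perm_eq d [:: 3; 3; 2; 2; 2; 2] \/ perm_eq d [:: 3; 3; 2; 2; 2; 2; 2].

(* Havel-Hakimi at a vertex of minimum degree makes its deletion harmless except
   for the sequences [(3,3,2^k,1^m)] and [(e,3,2^k)]. *)
Lemma delete_min (T : finType) (G : sgraph T) s x :
    house_free G -> uniq s -> x \in s -> 5 < size s -> rich G s ->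
    (forall y, y \in s -> count (G x) s <= count (G y) s) ->
    (forall u w, u \in s -> w \in s -> x != w -> G x u -> ~~ G x w ->
      count (G w) s <= count (G u) s) ->
  [\/ rich G (rem x s), small_exception (dseq G s)
    | exists e, perm_eq (dseq G s) [:: e, 3 & nseq (size s - 2) 2] /\ 3 < e].
Proof.
move=> hG us xs s5 [/allP pos c3_ c2_] x_min HH.
have sE := perm_to_rem xs; set s' := rem x s in sE *.
have ux : uniq (x :: s') by rewrite -(perm_uniq sE).
have ss : {subset s' <= s} by move=> y; apply: mem_rem.
have sz : size s = (size s').+1 by rewrite (perm_size sE).
pose f y := count (G y) s; pose g y := count (G y) s'.
have c3 : 2 <= count (fun y => 2 < f y) s := c3_.
have c2 : 5 <= count (fun y => 1 < f y) s := c2_.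
have fE y : f y = G x y + g y by rewrite /f (permP sE) /= adj_sym.
have fx : f x = g x by rewrite fE adj_irr.
have nx y : y \in s' -> x != y.
  by move=> ys; case/andP: ux => xs' _; apply: contraNneq xs' => ->.
pose N := [seq y <- s' | G x y]; pose R := [seq y <- s' | ~~ G x y].
have s'E : perm_eq s' (N ++ R) by rewrite perm_sym; apply/permPl; apply: perm_filterC.
have szN : size N = f x by rewrite size_filter fx.
have inN y : y \in N -> [/\ G x y, y \in s' & y \in s].
  by rewrite mem_filter => /andP [xy ys]; split; rewrite ?ss.
have inR y : y \in R -> [/\ ~~ G x y, y \in s' & y \in s].
  by rewrite mem_filter => /andP [xy ys]; split; rewrite ?ss.
have gN y : y \in N -> g y = (f y).-1 by case/inN => xy _ _; rewrite fE xy.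
have gR y : y \in R -> g y = f y by case/inR => xy _ _; rewrite fE (negbTE xy).
have NR u w : u \in N -> w \in R -> f w <= f u.
  by case/inN => xu _ su /inR [xw w' sw]; apply: HH => //; apply: nx.
have cs p : count p s = p x + (count p N + count p R).
  by rewrite (permP sE) /= (permP s'E) count_cat.
have cs' p : count p s' = count p N + count p R by rewrite (permP s'E) count_cat.
have cRg k : count (fun y => k < g y) R = count (fun y => k < f y) R.
  by apply: eq_in_count => y /gR ->.
have dsE : perm_eq (dseq G s) (f x :: map f N ++ map f R).
  rewrite -map_cat -map_cons; apply: perm_map.
  by apply: perm_trans sE _; rewrite perm_cons.
have fmin y : y \in s -> f x <= f y := x_min y.
have posf y : y \in s -> 0 < f y := pos y.
have fx0 := posf x xs.
have mk : all (fun y => 0 < g y) s' -> 2 <= count (fun y => 2 < g y) s' ->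
  5 <= count (fun y => 1 < g y) s' -> rich G s' by [].
clearbody f g N R; clear pos c3_ c2_ x_min HH.
(* With minimum degree at least 4, all remaining degrees stay at least 3. With minimum exactly 3
   they stay at least 2, and the nonneighbours of [x], at least two in number, keep degree at least
   3. *)
have [r3|r3] := leqP 3 (f x).
  constructor 1; have g2 y : y \in s' -> 1 < g y.
    by move=> ys; have := fmin y (ss y ys); rewrite [f y]fE; case: (G x y) => /=; arith.
  have all_count k t : {subset t <= s'} -> (forall y, y \in t -> k < g y) -> count (fun y => k < g y) t = size t.
    by move=> _ H; apply/eqP; rewrite -all_count; apply/allP.
  apply: mk; first by apply/allP => y /g2; apply: ltnW.
    have [r4|r4] := leqP 4 (f x).
      rewrite all_count //; first by arith.
      by move=> y ys; have := fmin y (ss y ys); rewrite [f y]fE; case: (G x y) => /=; arith.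
    rewrite cs' [X in _ + X]all_count.
    - by have := perm_size s'E; rewrite size_cat szN; arith.
    - by move=> y /inR [].
    - by move=> y yR; rewrite gR //; apply: leq_trans r3 (fmin y _); case/inR: yR.
  by rewrite all_count //; arith.
(* If a neighbour of [x] had degree at most 2, so would every nonneighbour by [NR]. Large vertices
   would then be fewer than the at most two neighbours, against [c3]. *)
have topN u : u \in N -> 2 < f u.
  move=> uN; rewrite ltnNge; apply/negP => fu.
  have cR : count (fun y => 2 < f y) R = 0.
    apply/eqP; rewrite -leqn0 leqNgt -has_count; apply/hasPn => y yR.
    by rewrite -leqNgt; apply: leq_trans (NR u y uN yR) fu.
  have cN : count (fun y => 2 < f y) N < size N.
    rewrite ltn_neqAle count_size andbT -all_count; apply/negP => /allP /(_ u uN).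
    by rewrite ltnNge fu.
  have x3 : (2 < f x) = false by arith.
  move: c3 cN; rewrite cs cR x3 szN; move: (count _ _) => k; arith.
have gpos : all (fun y => 0 < g y) s'.
  apply/allP => y; rewrite (perm_mem s'E) mem_cat => /orP [yN|yR].
    by rewrite gN //; have := topN y yN; arith.
  by rewrite gR //; apply: posf; case/inR: yR.
have c2N : count (fun y => 1 < g y) N = count (fun y => 1 < f y) N.
  by apply: eq_in_count => y yN; rewrite gN //; have := topN y yN; arith.
have c2' : 1 < f x -> count (fun y => 1 < f y) s = size s.
  move=> fx1; apply/eqP; rewrite -all_count; apply/allP => y ys.
  exact: leq_trans fx1 (fmin y ys).
have c2s' : 5 <= count (fun y => 1 < g y) s'.
  rewrite cs' c2N cRg; move: c2 (cs (fun y => 1 < f y)).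
  case: (ltnP 1 (f x)) => [/c2' ->|_]; last by move=> h hE; rewrite hE in h.
  by move=> _ szE; rewrite szE in s5.
(* The [c] large nonneighbours are spared by the deletion, so (1) can fail only through neighbours
   of degree exactly 3. *)
have [c cR] : {c | count (fun y => 2 < f y) R = c} by exists (count (fun y => 2 < f y) R).
have R_le2 : c = 0 -> all (fun y => f y <= 2) R.
  move=> c0; apply/allP => y yR; rewrite leqNgt; apply/negP => fy.
  by move/eqP: cR; rewrite c0 -leqn0 leqNgt -has_count => /hasPn /(_ y yR); rewrite fy.
have R_eq1 : c = 1 -> exists v, [/\ v \in R, 2 < f v & all (fun y => f y <= 2) (rem v R)].
  move=> c1; have /hasP [v vR fv] : has (fun y => 2 < f y) R by rewrite has_count cR c1.
  exists v; split=> //; apply/allP => y yR; rewrite leqNgt; apply/negP => fy.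
  move: cR; rewrite c1 (permP (perm_to_rem vR)) /= fv => -[] /eqP.
  by rewrite -leqn0 leqNgt -has_count => /hasPn /(_ y yR); rewrite fy.
have Rpos y : y \in R -> f x <= f y by case/inR => _ _ ys; apply: fmin.
have x3 : (2 < f x) = false by arith.
have c3s' : count (fun y => 2 < g y) s' = count (fun y => 2 < g y) N + c.
  by rewrite cs' cRg cR.
have c3s : 2 <= count (fun y => 2 < f y) N + c by move: c3; rewrite cs x3 cR.
have gtop u : u \in N -> (2 < g u) = (3 < f u).
  by move=> uN; rewrite gN //; have := topN u uN; case: (f u).
have c1s' : 5 <= (1 < f x) + (count (fun y => 1 < f y) N + count (fun y => 1 < f y) R).
  by rewrite -cs.
have [r2|r1] := leqP 2 (f x); last first.
  have := szN; case EN: N => [|u [|w N']] /=; [by arith | | by arith] => _.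
  have uN : u \in N by rewrite EN mem_head.
  have fu3 := topN u uN.
  have [c_big|c_small] := leqP 2 ((3 < f u) + c).
    by constructor 1; apply: mk => //; rewrite c3s' EN /= gtop // addn0.
  have [c1 fu] : c = 1 /\ f u = 3.
    by move: c3s c_small; rewrite EN /= fu3; case: (ltnP 3 (f u)) => /= fu4; arith.
  have [v [vR fv R2]] := R_eq1 c1.
  have fv3 : f v = 3 by have := NR u v uN vR; arith.
  have RE := perm_to_rem vR.
  constructor 2; apply: (dseq_33_12 (e := f x :: map f (rem v R)) hG us).
  - apply/permP => p; rewrite (permP dsE) EN /= (permP (perm_map f RE)) /= fu fv3.
    by rewrite !(addnCA (p (f x))).
  - rewrite /= all_map; apply/andP; split; first by arith.
    apply/allP => y yR /=; rewrite (allP R2) // andbT.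
    by apply: leq_trans fx0 (Rpos y _); apply: mem_rem yR.
  - move: c1s'; rewrite EN /= (permP RE) /= count_map.
    have -> : (1 < f x) = false by arith.
    rewrite fu fv3 /= !add0n !add1n !ltnS [count (preim _ _) _](eq_count (a2 := fun y => 1 < f y)) //.
have fx2 : f x = 2 by arith.
have [u0 [w0 EN]] : exists u0 w0, N = [:: u0; w0].
  have : size N = 2 by rewrite szN.
  by case: (N) => [|u0 [|w0 []]] // _; exists u0, w0.
have [u [w [Nuw fwu]]] : exists u w, perm_eq N [:: u; w] /\ f w <= f u.
  rewrite EN; have [h|/ltnW h] := leqP (f w0) (f u0); first by exists u0, w0.
  by exists w0, u0; rewrite (perm_catC [:: u0] [:: w0]).
have uN : u \in N by rewrite (perm_mem Nuw) mem_head.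
have wN : w \in N by rewrite (perm_mem Nuw) !inE eqxx orbT.
have fw3 := topN w wN.
have cN : count (fun y => 2 < g y) N = (3 < f u) + (3 < f w).
  by rewrite (permP Nuw) /= !gtop // addn0.
have [c_big|c_small] := leqP 2 ((3 < f u) + (3 < f w) + c).
  by constructor 1; apply: mk => //; rewrite c3s' cN.
have dsE' : perm_eq (dseq G s) [:: f u, f w, 2 & map f R].
  apply/permP => p; rewrite (permP dsE) fx2 /= count_cat (permP (perm_map f Nuw)) /=.
  by rewrite addn0 !addnA [p 2 + _]addnC -!addnA [p 2 + _]addnCA.
have szR : size s = (size R).+3.
  by rewrite sz (perm_size s'E) size_cat szN fx2.
have fw : f w = 3.
  by move: c_small; case: (ltnP 3 (f w)) => [fw4|]; [rewrite (leq_trans fw4 fwu) | arith].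
have R2 (R' : seq T) : {subset R' <= R} -> all (fun y => f y <= 2) R' -> map f R' = nseq (size R') 2.
  move=> sub /allP R'2; rewrite -(size_map f); apply/all_pred1P; rewrite all_map.
  apply/allP => y yR /=; rewrite eqn_leq R'2 //= -fx2; exact: Rpos (sub y yR).
have [c0|c0] := posnP c.
  have RE : map f R = nseq (size R) 2 by apply: R2; [move=> y | apply: R_le2].
  have [fu4|fu3] := ltnP 3 (f u).
    by constructor 3; exists (f u); split=> //; rewrite (permPl dsE') fw szR RE subn2.
  have fu : f u = 3 by have := topN u uN; arith.
  constructor 2; apply: (dseq_33_12 (e := 2 :: map f R) hG us).
  - by rewrite (permPl dsE') fu fw.
  - by rewrite RE /= all_nseq orbT.
  - by rewrite RE /= count_nseq /=; arith.
have c1 : c = 1 by move: c_small; rewrite ltnS; arith.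
have fu : f u = 3.
  by move: c_small (topN u uN); rewrite c1; case: (ltnP 3 (f u)) => //; arith.
have [v [vR fv Rv]] := R_eq1 c1.
have fv3 : f v = 3 by have := NR u v uN vR; arith.
(* Three degrees 3 with all others 2 would give an odd degree sum. *)
have := sumn_dseq_even G s; rewrite (perm_sumn dsE') /= (perm_sumn (perm_map f (perm_to_rem vR))) /=.
rewrite fu fw fv3 R2 //; last by move=> y; apply: mem_rem.
by rewrite sumn_nseq mul2n !oddD odd_double.
Qed.

(** A vertex adjacent to both [u] and [w] would pull [w] down to degree 2. One adjacent to [u] alone
    can be deleted safely: [u] has degree to spare, and only one vertex of degree 2 is lost to
    degree 1. *)
Lemma delete_degree_two (T : finType) (G : sgraph T) s e :
    uniq s -> 5 < size s -> perm_eq (dseq G s) [:: e, 3 & nseq (size s - 2) 2] -> 3 < e ->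
  has_core G s \/ exists2 x, x \in s & rich G (rem x s).
Proof.
move=> us s5 /perm_map_preim [[|u [|w t]] sE //= [fu fw ft]] e3.
have {ft} f2 y : y \in t -> count (G y) s = 2.
  by move=> yt; have := map_f (fun x => count (G x) s) yt; rewrite ft mem_nseq => /andP [_ /eqP].
have sz : size s = (size t).+2 by rewrite (perm_size sE).
have fE y : count (G y) s = G y u + (G y w + count (G y) t) by rewrite (permP sE).
(* By parity of the degree sum [e] is odd. *)
have e4 : 4 < e.
  have := sumn_dseq_even G s; rewrite (perm_sumn (perm_map _ sE)) /= fu fw.
  rewrite (eq_in_map _ (fun=> 2) t).1 //.
  have -> : forall t' : seq T, sumn [seq 2 | _ <- t'] = (size t').*2.
    by elim=> //= _ t' ->; rewrite doubleS.
  rewrite !oddD odd_double addbF /=; case: (e) e3 => // -[|[|[|[|[|e']]]]] //.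
have uuwt : uniq [:: u, w & t] by rewrite -(perm_uniq sE).
(* Such an [x] exists because [u] has more neighbours in [t] than [w]. *)
have [x xt /andP [xu xw]] : exists2 x, x \in t & G x u && ~~ G x w.
  apply/hasP; rewrite has_count; set k := count _ _.
  have : count (G u) t <= k + count (G w) t.
    rewrite /k -count_predUI; apply: leq_trans (leq_addr _ _); apply: sub_count => x /=.
    by rewrite [G u x]adj_sym [G w x]adj_sym => ->; case: (G x w); rewrite ?orbT.
  move: fu fw; rewrite !fE !adj_irr [G w u]adj_sym.
  by move: (count _ _) (count _ _) k => a b k; case: (G u w); arith.
have tE := perm_to_rem xt; set t' := rem x t in tE.
have tt' y : y \in t' -> y \in t by apply: mem_rem.
have szt : size t = (size t').+1 by rewrite (perm_size tE).
have xs : x \in s by rewrite (perm_mem sE) !inE xt !orbT.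
have s'E : perm_eq (rem x s) [:: u, w & t'].
  apply/permP => p; have := permP (perm_to_rem xs) p.
  by rewrite (permP sE) /= (permP tE) /=; arith.
pose g y := count (G y) (rem x s).
have fg y : count (G y) s = G y x + g y by rewrite (permP (perm_to_rem xs)).
have gu : g u = e.-1 by move: fu; rewrite fg adj_sym xu => <-.
have gw : g w = 3 by move: fw; rewrite fg adj_sym (negbTE xw).
have g2 y : y \in t' -> g y = 2 - G x y.
  by move=> /tt' /f2; rewrite fg adj_sym; case: (G x y) => /=; arith.
have x1 : count (G x) t' = 1.
  by move: (f2 x xt); rewrite fE (permP tE) /= adj_irr xu (negbTE xw) => -[].
(* On six vertices [e] must be 5, and the sequence is itself the second core. *)
have [s6|s6] := leqP (size s) 6.
  left; exists G, s; split=> //; right.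
  have t4 : size t = 4 by arith.
  have e5 : e <= 5.
    rewrite -fu fE adj_irr add0n -[5]/(1 + 4) -t4.
    by apply: leq_add; [case: (G u w) | apply: count_size].
  rewrite (permPl (perm_map _ sE)) /= fu fw.
  have -> : e = 5 by arith.
  rewrite !perm_cons (eq_in_map _ (fun=> 2) t).1 //.
  by move: t4; case: (t) => [|? [|? [|? [|? []]]]].
right; exists x => //; rewrite /rich -/g; split.
- rewrite (perm_all _ s'E) /= -/(g u) -/(g w) gu gw -ltnS prednK; last by arith.
  rewrite (ltn_trans _ e4) //=; apply/allP => y yt; rewrite -/(g y) g2 //.
  by case: (G x y).
- rewrite (permP s'E) /= -/(g u) -/(g w) gu gw /=.
  by have -> : 2 < e.-1 by arith.
rewrite (permP s'E) /= -/(g u) -/(g w) gu gw /=.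
have -> : 1 < e.-1 by arith.
rewrite (eq_in_count (a2 := predC (G x))); last first.
  by move=> y yt; rewrite -/(g y) g2 //=; case: (G x y).
have t'4 : 3 < size t' by arith.
move: (count_predC (G x) t'); rewrite x1; move: (count _ _) => k kE.
by rewrite -kE in t'4; rewrite !add1n !ltnS; rewrite add1n !ltnS in t'4.
Qed.

Lemma find_core (T : finType) (G : sgraph T) s :
    house_free G -> uniq s -> rich G s ->
  has_core G s \/ small_exception (dseq G s).
Proof.
have [n] := ubnP (size s); elim: n G s => // n IH G s lts hG us [pos c3 c2].
have s5 : 5 <= size s by apply: leq_trans c2 (count_size _ _).
have [s5'|s6] := eqVneq (size s) 5.
  by left; apply: core5 => //; rewrite count_map.
have {s5 s6} s6 : 5 < size s by rewrite ltn_neqAle eq_sym s6.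
have step (G' : sgraph T) x : switch_equiv s G G' -> x \in s -> rich G' (rem x s) -> has_core G s.
  move=> eG xs rG'; have hG' := switch_equiv_house_free us eG hG.
  have ux : uniq (x :: rem x s) by rewrite -(perm_uniq (perm_to_rem xs)).
  have ur : uniq (rem x s) by case/andP: ux.
  have x_pos : 0 < count (G' x) (rem x s).
    have /allP /(_ x xs) := pos; case: eG => _ /(_ x xs) <-.
    by rewrite (permP (perm_to_rem xs)) /= adj_irr.
  case: (IH G' (rem x s)) => //.
  - by rewrite size_rem //; case: (size s) lts s6.
  - by apply: has_core_sub => // y; apply: mem_rem.
  (* A small exception on [rem x s] is impossible, since [x] is a further vertex with a neighbour
     there. *)
  by case; move/(house_free_extension _ hG' ux x_pos); case; vm_compute.
have [x0 x0s] : exists x0, x0 \in s by case: (s) s6 => // x0 s' _; exists x0; apply: mem_head.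
pose x := [arg min_(y < x0 | y \in s) count (G y) s].
have [xs x_min] : x \in s /\ forall y, y \in s -> count (G x) s <= count (G y) s.
  by rewrite /x; case: arg_minnP.
have [G' eG HH] := havel_hakimi G us xs.
have hG' := switch_equiv_house_free us eG hG.
have dE y : y \in s -> count (G' y) s = count (G y) s by case: eG => _; apply.
have rG' : rich G' s.
  split; first by apply/allP => y ys; rewrite dE //; apply: (allP pos).
  - by rewrite (eq_in_count (a2 := fun y => 2 < count (G y) s)) // => y /dE ->.
  - by rewrite (eq_in_count (a2 := fun y => 1 < count (G y) s)) // => y /dE ->.
have x_min' y : y \in s -> count (G' x) s <= count (G' y) s.
  by move=> ys; rewrite !dE // x_min.
have [rG'x|se|[e [eE e3]]] := delete_min hG' us xs s6 rG' x_min' HH.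
- by left; apply: step eG xs rG'x.
- by right; rewrite -(switch_equiv_dseq eG).
have [core|[y ys ry]] := delete_degree_two us s6 eE e3; left.
  by apply: has_core_sub core.
exact: step eG ys ry.
Qed.

(** * From a core to the excluded families *)

(** Family (3). The first vertex is adjacent to all others; without it there remain a star with
    [k - 1] leaves, disjoint edges and isolated vertices, whence the parity condition. *)
Definition star_type (n : nat) (d : seq nat) : Prop := exists k t,
  [/\ 3 <= k <= n - 2, 3 <= t <= n - 2, odd k != odd t &
    perm_eq d ([:: n - 1; k] ++ nseq t 2 ++ nseq (n - 2 - t) 1)].

(** Family (4). In a realization the two large vertices are adjacent and meet every edge: [i]
    triangles share their common edge, and the remaining vertices are pendant. *)
Definition book_type (n : nat) (d : seq nat) : Prop := exists i k,
  [/\ 1 <= k <= (n - 1) %/ 2 - 1, 3 <= i <= n - 2 * k &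
    perm_eq d ([:: n - k; k + i] ++ nseq i 2 ++ nseq (n - i - 2) 1)].

(* A vertex outside the core sees nothing, the centre, or both large vertices; two
   adjacent outside vertices see only the centre; and no outside vertex has two outside
   neighbours. *)
Definition star_core_test (m k0 : nat) : bool :=
  let core := [:: m.+1, k0 & nseq m 2] in
  let row x y := [:: x, y & nseq m false] in
  let rows := [:: row false false; row true false; row true true] in
  [&& all (fun b => (b \in rows) || house_test (extend_dseq core b)) (bits m.+2),
      all (fun b => all (fun b' => (b == row true false) && (b' == row true false) ||
        house_test (extend_dseq (extend_dseq core b) (true :: b'))) rows) rows
    & all (fun x => house_test (extend_dseq (extend_dseq (extend_dseq core (row true false))
        (true :: row true false)) [:: x, true & row true false])) [:: true; false]].

Lemma nseq_map_const (T : eqType) (f : T -> nat) c t :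
  {in t, forall y, f y = c} -> map f t = nseq (size t) c.
Proof.
move=> fc; rewrite -(size_map f); apply/all_pred1P; rewrite all_map.
by apply/allP => y yt /=; rewrite fc.
Qed.

(** The centre [v1] turns out to be adjacent to every vertex, and all vertices except [v1] and [v2]
    have degree 1 or 2. The handshake lemma then supplies the parity condition. *)
Lemma star_core (T : finType) (G : sgraph T) s t0 m k0 :
    star_core_test m k0 -> 3 <= k0 <= m ->
    house_free G -> uniq s -> all (fun y => 0 < count (G y) s) s ->
    uniq t0 -> {subset t0 <= s} -> perm_eq (dseq G t0) [:: m.+1, k0 & nseq m 2] ->
  star_type (size s) (dseq G s).
Proof.
move=> /and3P [/allP test1 /allP test2 /allP test3] k0m hG us /allP pos ut0 ts0.
case/dseq_perm_preim => t1 tt1; case: t1 tt1 => [|v1 [|v2 t]] // tt1 core.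
have ut : uniq [:: v1, v2 & t] by rewrite -(perm_uniq tt1).
have ts : {subset [:: v1, v2 & t] <= s} by move=> y; rewrite -(perm_mem tt1); apply: ts0.
clear ut0 ts0 tt1 t0.
set row := fun x y : bool => [:: x, y & nseq m false] in test1 test2 test3.
set rows := [:: row false false; row true false; row true true] in test1 test2.
have mt : size t = m by move/(congr1 size): core; rewrite /= size_map size_nseq => -[].
pose q := [seq y <- s | y \notin [:: v1, v2 & t]].
have sE : perm_eq s ([:: v1, v2 & t] ++ q) by apply: perm_cat_sub.
have uq : uniq q by apply: filter_uniq.
have qs y : y \in q -> (y \in s) * (y \notin [:: v1, v2 & t]).
  by rewrite mem_filter => /andP [-> ->].
have cs p : count p s = p v1 + (p v2 + (count p t + count p q)).
  by rewrite (permP sE) /= count_cat.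
have row_in r : r \in q -> map (G r) [:: v1, v2 & t] \in rows.
  move=> rq; set b := map _ _; have sb : size b = m.+2 by rewrite /= size_map mt.
  have := test1 b; rewrite -sb mem_bits => /(_ isT) /orP [] //.
  rewrite -core -dseq_cons house_free_test //=.
  by rewrite (qs r rq).2; have := ut.
have edge r r' : r \in q -> r' \in q -> G r r' ->
    (map (G r) [:: v1, v2 & t] = row true false) * (map (G r') [:: v1, v2 & t] = row true false).
  move=> rq r'q rr'.
  have /allP := test2 _ (row_in r rq); move=> /(_ _ (row_in r' r'q)) /orP [/andP [/eqP -> /eqP ->] //|].
  have -> : true :: map (G r') [:: v1, v2 & t] = map (G r') [:: r, v1, v2 & t].
    by rewrite /= [G r' r]adj_sym rr'.
  rewrite -core -!dseq_cons house_free_test //.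
  rewrite cons_uniq inE negb_or (qs r' r'q).2 cons_uniq (qs r rq).2 ut !andbT.
  by apply: contraTneq rr' => ->; rewrite adj_irr.
(* A vertex that sees nothing in the core has an outside neighbour, its degree being positive; but
   an outside edge forces both its ends to see the centre. *)
have v1q r : r \in q -> G r v1.
  move=> rq; have := row_in r rq; rewrite !inE => /or3P [] /eqP; [|by case..].
  case=> r1 r2 rt; have := pos r (qs r rq).1.
  have ct : count (G r) t = 0.
    by have := count_map (G r) id t; rewrite rt count_nseq mul0n => <-.
  rewrite cs r1 r2 ct !add0n -has_count => /hasP [r' r'q rr'].
  by have [[]] := edge r r' rq r'q rr'; rewrite r1.
have tq r c : r \in q -> c \in t -> G r c = false.
  move=> rq ct; have := row_in r rq; rewrite !inE => rE.
  have : map (G r) t = nseq m false by case/or3P: rE => /eqP [_ _].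
  by move/(map_f (G r)): ct => + rt; rewrite rt mem_nseq => /andP [_ /eqP].
(* Besides the centre, [r] sees either [v2] or outside vertices, never both; the third test rules
   out two outside neighbours. *)
have degq r : r \in q -> 0 < count (G r) s <= 2.
  move=> rq; rewrite pos ?(qs r rq).1 //= cs v1q //.
  have -> : count (G r) t = 0.
    by apply/eqP; rewrite -leqn0 leqNgt -has_count; apply/hasPn => c /(tq r c rq) ->.
  case Nr: [seq y <- q | G r y] => [|r1 [|r2 Nr']].
  - by rewrite -size_filter Nr; case: (G r v2).
  - have : r1 \in [seq y <- q | G r y] by rewrite Nr mem_head.
    rewrite mem_filter => /andP [rr1 r1q].
    have [[_ -> _] _] := edge r r1 rq r1q rr1.
    by rewrite -size_filter Nr.
  have : r1 \in [seq y <- q | G r y] by rewrite Nr mem_head.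
  rewrite mem_filter => /andP [rr1 r1q].
  have : r2 \in [seq y <- q | G r y] by rewrite Nr !inE eqxx orbT.
  rewrite mem_filter => /andP [rr2 r2q].
  have r12 : r1 != r2.
    have : uniq [seq y <- q | G r y] by apply: filter_uniq.
    by rewrite Nr /= inE negb_or => /andP [/andP [] //].
  have [E1 E2] := edge r r1 rq r1q rr1.
  have [_ E3] := edge r r2 rq r2q rr2.
  have := test3 (G r2 r1).
  have -> : [:: G r2 r1, true & row true false] = map (G r2) [:: r1, r, v1, v2 & t].
    by rewrite -E3 /= [G r2 r]adj_sym rr2.
  have -> : true :: row true false = map (G r1) [:: r, v1, v2 & t].
    by rewrite -E2 /= [G r1 r]adj_sym rr1.
  rewrite -[_ :: _ :: nseq m false]E1 -core -!dseq_cons house_free_test //.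
    by case: (G r2 r1) => /(_ isT).
  have [rr1' rr2'] : r1 != r /\ r2 != r.
    by split; [apply: contraTneq rr1 | apply: contraTneq rr2] => ->; rewrite adj_irr.
  rewrite !(cons_uniq, inE, negb_or) [r2 == r1]eq_sym r12 rr1' rr2' /=.
  have := (qs r rq).2; have := (qs r1 r1q).2; have := (qs r2 r2q).2.
  rewrite !inE !negb_or => /and3P [-> -> ->] /and3P [-> -> ->] /and3P [-> -> ->] /=.
  by move: ut; rewrite !(cons_uniq, inE, negb_or).
have [core1 core2 coret] : [/\ count (G v1) [:: v1, v2 & t] = m.+1,
    count (G v2) [:: v1, v2 & t] = k0 &
    map (fun y => count (G y) [:: v1, v2 & t]) t = nseq m 2] by case: core.
have split_count p : count p s = count p [:: v1, v2 & t] + count p q.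
  by rewrite (permP sE) count_cat.
have degt c : c \in t -> count (G c) s = 2.
  move=> ct; have : count (G c) [:: v1, v2 & t] \in nseq m 2.
    by rewrite -coret; apply: (map_f (fun y => count (G y) _)).
  rewrite mem_nseq split_count => /andP [_ /eqP ->].
  suff -> : count (G c) q = 0 by [].
  apply/eqP; rewrite -leqn0 leqNgt -has_count; apply/hasPn => r rq.
  by rewrite adj_sym tq.
have sz : size s = m.+2 + size q by rewrite (perm_size sE) size_cat /= mt.
have deg1 : count (G v1) s = size s - 1.
  rewrite split_count core1 sz; suff -> : count (G v1) q = size q by arith.
  by apply/eqP; rewrite -all_count; apply/allP => r rq; rewrite adj_sym v1q.
have deg2 : 3 <= count (G v2) s <= size s - 2.
  by rewrite split_count core2 sz; have := count_size (G v2) q;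
  move: (count (G v2) q) (size q) => a b; move: k0m; arith.
set e := map (fun y => count (G y) s) (t ++ q).
have e12 : all (fun x => 0 < x <= 2) e.
  rewrite all_map; apply/allP => y; rewrite mem_cat /= => /orP [/degt -> //|]; exact: degq.
have dE : perm_eq (dseq G s) [:: size s - 1, count (G v2) s & e].
  by rewrite -deg1; apply: perm_map sE.
have sze : size e = size s - 2 by rewrite size_map size_cat mt sz !addSn subn2.
have eE := perm_eq_12 e12.
have m_e2 : m <= count_mem 2 e.
  by rewrite /e map_cat count_cat (nseq_map_const degt) mt count_nseq /= mul1n leq_addr.
have e1 : count_mem 1 e = size s - 2 - count_mem 2 e.
  have := perm_size eE; rewrite size_cat !size_nseq sze; move: (count_mem 1 e) => k ->.
  by rewrite addKn.
exists (count (G v2) s), (count_mem 2 e); split=> //.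
- apply/andP; split; first by arith.
  by rewrite -sze count_size.
- have := sumn_dseq_even G s; rewrite (perm_sumn dE) /= (perm_sumn eE) e1 sumn_cat !sumn_nseq.
  have e2_le : count_mem 2 e <= size s - 2 by rewrite -sze count_size.
  have s2 : size s = (size s - 2).+2 by rewrite sz !addSn subn2.
  rewrite {1}s2 subn1 /=; move: e2_le; move: (count_mem 2 e) (count (G v2) s) (size s - 2).
  move=> c k r cr; rewrite -(subnKC cr) addKn mul2n mul1n /= !oddD odd_double.
  by move: (odd c) (odd k) (odd (r - c)) => [] [] [].
by rewrite -e1 (permPl dE) !perm_cons.
Qed.

Lemma star_core5 : star_core_test 4 3.
Proof. by vm_compute. Qed.

(** The sequence (6,4,2^5) arises from the core (4,4,2,2,2) by attaching two adjacent vertices to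
    the same large vertex. *)
Lemma star_core6 : star_core_test 5 4.
Proof. by vm_compute. Qed.

(* Two adjacent vertices outside the core see the same large vertex and nothing else. *)
Definition book_core_test : bool :=
  let core := [:: 4; 4; 2; 2; 2] in
  let row x y := [:: x, y & nseq 3 false] in
  let rows := [:: row false false; row true false; row false true; row true true] in
  all (fun b => (b \in rows) || house_test (extend_dseq core b)) (bits 5) &&
  all (fun b => all (fun b' => (b == b') && (b \in [:: row true false; row false true]) ||
    house_test (extend_dseq (extend_dseq core b) (true :: b'))) rows) rows.

Lemma book_core_testP : book_core_test.
Proof. by vm_compute. Qed.

(** An edge outside the core enlarges it to the star core (6,4,2^5). Without such an edge every
    outside vertex sees only [v1] and [v2], and counting edges gives the book family. *)
Lemma book_core (T : finType) (G : sgraph T) s t0 :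
    house_free G -> uniq s -> all (fun y => 0 < count (G y) s) s ->
    uniq t0 -> {subset t0 <= s} -> perm_eq (dseq G t0) [:: 4; 4; 2; 2; 2] ->
  star_type (size s) (dseq G s) \/ book_type (size s) (dseq G s).
Proof.
have /andP [/allP test1 /allP test2] := book_core_testP.
move=> hG us pos0; have /allP pos := pos0; move=> ut0 ts0.
case/dseq_perm_preim => t1 tt1; case: t1 tt1 => [|v1 [|v2 t]] // tt1 core.
have ut : uniq [:: v1, v2 & t] by rewrite -(perm_uniq tt1).
have ts : {subset [:: v1, v2 & t] <= s} by move=> y; rewrite -(perm_mem tt1); apply: ts0.
clear ut0 ts0 tt1 t0.
have mt : size t = 3 by move/(congr1 size): core; rewrite /= size_map => -[].
pose q := [seq y <- s | y \notin [:: v1, v2 & t]].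
have sE : perm_eq s ([:: v1, v2 & t] ++ q) by apply: perm_cat_sub.
have qs y : y \in q -> (y \in s) * (y \notin [:: v1, v2 & t]).
  by rewrite mem_filter => /andP [-> ->].
have [|/hasPn no_edge] := boolP (has (fun r => has (G r) q) q).
  case/hasP => r rq /hasP [r' r'q rr']; left.
  have row_in y : y \in q -> map (G y) [:: v1, v2 & t] \in
      [:: [:: false, false & nseq 3 false]; [:: true, false & nseq 3 false];
          [:: false, true & nseq 3 false]; [:: true, true & nseq 3 false]].
    move=> yq; set b := map _ _; have sb : size b = 5 by rewrite /= size_map mt.
    have := test1 b; rewrite -sb mem_bits => /(_ isT) /orP [] //.
    rewrite -core -dseq_cons house_free_test //=.
    by rewrite (qs y yq).2; have := ut.
  have r'r : r' != r by apply: contraTneq rr' => ->; rewrite adj_irr.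
  have ut' : uniq [:: r', r, v1, v2 & t].
    by rewrite cons_uniq inE negb_or r'r (qs r' r'q).2 cons_uniq (qs r rq).2.
  have rE : true :: map (G r') [:: v1, v2 & t] = map (G r') [:: r, v1, v2 & t].
    by rewrite /= [G r' r]adj_sym rr'.
  have /allP := test2 _ (row_in r rq); move=> /(_ _ (row_in r' r'q)) /orP []; last first.
    by rewrite rE -core -!dseq_cons house_free_test.
  move=> /andP [/eqP rr'E rrow].
  apply: (star_core (t0 := [:: r', r, v1, v2 & t]) star_core6) => //.
    move=> y; rewrite in_cons => /orP [/eqP -> |]; first by rewrite (qs r' r'q).1.
    by rewrite in_cons => /orP [/eqP -> |]; [rewrite (qs r rq).1 | apply: ts].
  rewrite dseq_cons -rE -rr'E dseq_cons core.
  by move: rrow; rewrite !inE => /orP [] /eqP ->.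
right.
have row_in r : r \in q -> map (G r) t = nseq 3 false.
  move=> rq; set b := map (G r) [:: v1, v2 & t].
  have sb : size b = 5 by rewrite /= size_map mt.
  have := test1 b; rewrite -sb mem_bits => /(_ isT) /orP [].
    by rewrite !inE => /or4P [] /eqP [].
  rewrite -core -dseq_cons house_free_test //=.
  by rewrite (qs r rq).2; have := ut.
have tq r c : r \in q -> c \in t -> G r c = false.
  by move=> rq /(map_f (G r)); rewrite row_in // mem_nseq => /andP [_ /eqP].
have [core1 core2 coret] : [/\ count (G v1) [:: v1, v2 & t] = 4,
    count (G v2) [:: v1, v2 & t] = 4 &
    map (fun y => count (G y) [:: v1, v2 & t]) t = nseq 3 2] by case: core.
have split_count p : count p s = count p [:: v1, v2 & t] + count p q.
  by rewrite (permP sE) count_cat.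
have degt c : c \in t -> count (G c) s = 2.
  move=> ct; have : count (G c) [:: v1, v2 & t] \in nseq 3 2.
    by rewrite -coret; apply: (map_f (fun y => count (G y) _)).
  rewrite mem_nseq split_count => /andP [_ /eqP ->].
  suff -> : count (G c) q = 0 by [].
  apply/eqP; rewrite -leqn0 leqNgt -has_count; apply/hasPn => r rq.
  by rewrite adj_sym tq.
have degq r : r \in q -> count (G r) s = G r v1 + G r v2.
  move=> rq; rewrite split_count /=.
  have -> : count (G r) t = 0.
    by apply/eqP; rewrite -leqn0 leqNgt -has_count; apply/hasPn => c /(tq r c rq) ->.
  have -> : count (G r) q = 0.
    by apply/eqP; rewrite -leqn0 leqNgt -has_count; apply: no_edge.
  by rewrite !addn0.
have q12 : all (fun x => 0 < x <= 2) (map (fun y => count (G y) s) q).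
  rewrite all_map; apply/allP => r rq /=; rewrite pos ?(qs r rq).1 // degq //.
  by case: (G r v1) (G r v2) => [] [].
have sz : size s = 5 + size q by rewrite (perm_size sE) size_cat /= mt.
have sumq : sumn (map (fun y => count (G y) s) q) = count (G v1) q + count (G v2) q.
  have -> : map (fun y => count (G y) s) q = map (fun y => G v1 y + G v2 y) q.
    by apply/eq_in_map => r rq; rewrite degq // ![G r _]adj_sym.
  by elim: (q) => //= r q' ->; rewrite addnACA.
have qE := perm_eq_12 q12.
set B := count_mem 2 _ in qE; set A := count_mem 1 _ in qE.
have szq : size q = B + A.
  by rewrite -(size_map (fun y => count (G y) s)) (perm_size qE) size_cat !size_nseq.
rewrite (perm_sumn qE) sumn_cat !sumn_nseq in sumq.
have dE : perm_eq (dseq G s) ([:: 4 + count (G v1) q; 4 + count (G v2) q] ++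
    nseq (3 + B) 2 ++ nseq A 1).
  rewrite (permPl (perm_map _ sE)) map_cat /= !split_count -/(count _ (_ :: _)) core1 core2.
  rewrite !perm_cons (nseq_map_const degt) mt.
  by rewrite (nseqD 3) -catA perm_cat2l.
have c1 := count_size (G v1) q; have c2 := count_size (G v2) q.
move: dE sumq c1 c2; move: (count (G v1) q) (count (G v2) q) => n1 n2.
clearbody A B.
(* Family (4) lists the larger degree first; the bound [i <= n - 2 * k] amounts to this
   inequality. *)
wlog n12 : n1 n2 / n2 <= n1 => [wl dE|dE sumq c1 c2].
  case/orP: (leq_total n2 n1) => [/wl|/wl W sumq c1 c2]; first by apply.
  apply: W => //; last by rewrite [RHS]addnC.
  apply: perm_trans dE _.
  by rewrite perm_cat2r; apply/permP => p /=; rewrite addnCA.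
clear - sz szq dE sumq c1 n12.
rewrite szq in sz c1; move: (size s) sz dE => n ->.
(* Here [i] is the number of vertices of degree 2, three of them in the core, and [k] is [n] minus
   the degree of [v1]. *)
exists (3 + B), (5 + (B + A) - (4 + n1)); split.
- apply/andP; split; first by lia.
  rewrite leq_subRL; last by rewrite leq_divRL //; lia.
  by rewrite leq_divRL //; lia.
- by lia.
have -> : 5 + (B + A) - (5 + (B + A) - (4 + n1)) = 4 + n1 by lia.
have -> : 5 + (B + A) - (4 + n1) + (3 + B) = 4 + n2 by lia.
have -> : 5 + (B + A) - (3 + B) - 2 = A by lia.
exact: dE.
Qed.

Lemma has_core_type (T : finType) (G : sgraph T) s :
    house_free G -> uniq s -> rich G s -> has_core G s ->
  star_type (size s) (dseq G s) \/ book_type (size s) (dseq G s).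
Proof.
move=> hG us [pos _ _] [G' [t [eG ut ts]]].
have hG' := switch_equiv_house_free us eG hG.
have pos' : all (fun y => 0 < count (G' y) s) s.
  by apply/allP => y ys; case: eG => _ -> //; apply: (allP pos).
rewrite -(switch_equiv_dseq eG) => -[core|core].
  exact: book_core core.
by left; apply: (star_core star_core5) core.
Qed.

(** * Nonincreasing sequences *)

(** Turns bounds on single terms into counts, which do not depend on the order. With [0 < k] the
    default value 0 of [nth] never satisfies the bound. *)
Lemma sorted_nth_count d i k :
  sorted geq d -> 0 < k -> (k <= nth 0 d i) = (i < count (leq k) d).
Proof.
move=> + k0; elim: d i => [|x d IH] i; first by rewrite nth_nil leqNgt k0.
rewrite /= (path_sortedE (rev_trans leq_trans)) => /andP [/allP xd /IH {}IH].
have small : x < k -> count (leq k) d = 0.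
  move=> xk; apply/eqP; rewrite -leqn0 leqNgt -has_count; apply/hasPn => y /xd yx.
  by rewrite -ltnNge; apply: leq_ltn_trans yx xk.
case: (leqP k x) => [kx|/[dup] xk /small c0].
  by case: i => [|i] /=; rewrite ?kx ?IH.
by case: i => [|i] /=; rewrite ?IH c0 // leqNgt xk.
Qed.

Lemma sorted_two_steps a b t m :
  b <= a -> 2 <= b -> sorted geq ([:: a; b] ++ nseq t 2 ++ nseq m 1).
Proof.
move=> ba b2 /=; rewrite ba /=; elim: t b b2 {ba} => [|t IH] b b2 /=.
  by elim: m b b2 => //= m IH b b2; rewrite (ltnW b2) /=; elim: m {IH}.
by rewrite b2 IH.
Qed.

Lemma sorted_perm_eq d d' : sorted geq d -> sorted geq d' -> perm_eq d d' -> d = d'.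
Proof.
apply: sorted_eq; first exact: rev_trans leq_trans.
by move=> x y; rewrite andbC -eqn_leq => /eqP.
Qed.

Lemma perm_realization d (T : finType) (G : sgraph T) :
  realization d G -> perm_eq (dseq G (enum T)) d.
Proof. by rewrite dseq_enum => <-; rewrite perm_sym /degree_seq perm_sort. Qed.

Lemma has_house_potentially d :
  sorted geq d -> has_house_realization d -> potentially K5_minus_P4 d.
Proof.
move=> sd [T [G [Gd Gh]]]; exists T, G; split=> //.
apply: sorted_perm_eq => //.
  by apply: sort_sorted => x y; apply: leq_total.
by rewrite /degree_seq perm_sort -dseq_enum.
Qed.

Lemma leq_size_count (T : finType) (p : pred T) t :
  uniq t -> all p t -> size t <= count p (enum T).
Proof.
move=> ut /allP pt; rewrite -size_filter; apply: uniq_leq_size => // x /pt px.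
by rewrite mem_filter px mem_enum.
Qed.

(** * The excluded sequences admit no house *)

(** The chord is [a b], its apex is [c], and [u w] is the side of the square a-b-w-u opposite to the
    chord. *)
Record house_at (T : finType) (G : sgraph T) (a b c u w : T) : Prop := HouseAt {
  house_uniq : uniq [:: a; b; c; u; w];
  house_ab : G a b; house_ac : G a c; house_bc : G b c;
  house_au : G a u; house_bw : G b w; house_uw : G u w
}.

Lemma contains_house_at (T : finType) (G : sgraph T) :
  contains K5_minus_P4 G -> exists a b c u w, house_at G a b c u w.
Proof.
move=> [f [fi fK]]; pose o k (lt : k < 5) := f (Ordinal lt).
exists (@o 0 isT), (@o 4 isT), (@o 2 isT), (@o 3 isT), (@o 1 isT).
split; try exact: fK.
rewrite -[[:: _; _; _; _; _]]/(map f [:: Ordinal (isT : 0 < 5); Ordinal (isT : 4 < 5);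
  Ordinal (isT : 2 < 5); Ordinal (isT : 3 < 5); Ordinal (isT : 1 < 5)]).
by rewrite map_inj_uniq.
Qed.

Lemma house_atC (T : finType) (G : sgraph T) a b c u w :
  house_at G a b c u w -> house_at G b a c w u.
Proof.
case=> U ab ac bc au bw uw; split; rewrite // 1?adj_sym //.
rewrite (perm_uniq (s2 := [:: a; b; c; u; w])) //.
rewrite -[[:: b; a; c; w; u]]/([:: b; a; c] ++ [:: w; u]) -[[:: a; b; c; u; w]]/([:: a; b; c] ++ [:: u; w]).
by apply: perm_cat; apply/permP => p /=; rewrite addnCA.
Qed.

Section House.
Variables (T : finType) (G : sgraph T) (a b c u w : T).
Hypothesis H : house_at G a b c u w.
Let fs := [:: a; b; c; u; w].

Lemma house_counts : [/\ 3 <= count (G a) fs, 3 <= count (G b) fs, 2 <= count (G c) fs,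
  2 <= count (G u) fs & 2 <= count (G w) fs].
Proof.
case: H => _ ab ac bc au bw uw; rewrite /fs /= !adj_irr ab ac au bc bw uw.
rewrite [G b a]adj_sym [G c a]adj_sym [G c b]adj_sym [G u a]adj_sym [G w b]adj_sym [G w u]adj_sym.
by rewrite ab ac au bc bw uw; split; rewrite // ?addn0 ?add1n ?addnS.
Qed.

Lemma house_degs : [/\ 3 <= deg G a, 3 <= deg G b, 2 <= deg G c,
  2 <= deg G u & 2 <= deg G w].
Proof.
have le p : count p fs <= count p (enum T).
  rewrite -size_filter; apply: leq_size_count; last exact: filter_all.
  by apply: filter_uniq; case: H.
case: house_counts => ha hb hc hu hw; rewrite !deg_count.
by split; [apply: leq_trans ha _ | apply: leq_trans hb _ | apply: leq_trans hc _
  | apply: leq_trans hu _ | apply: leq_trans hw _].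
Qed.
End House.

Lemma house_top_edges (T : finType) (G : sgraph T) a b c u w :
  house_at G a b c u w -> G a w -> 3 <= deg G w.
Proof.
case=> U ab ac bc au bw uw aw; rewrite deg_count.
apply: (@leq_size_count _ _ [:: a; b; u]); last first.
  by rewrite /= [G w a]adj_sym [G w b]adj_sym [G w u]adj_sym aw bw uw.
by move: U; rewrite /= !inE !negb_or; case/and5P => /and4P [-> _ -> _] /and3P [_ -> _].
Qed.

Lemma two_large (T : finType) (G : sgraph T) a b e :
    perm_eq (dseq G (enum T)) [:: a, b & e] -> all (fun x => x <= 2) e ->
  exists v1 v2 r, [/\ perm_eq (enum T) [:: v1, v2 & r], deg G v1 = a, deg G v2 = b,
    map (deg G) r = e & forall x, 2 < deg G x -> x = v1 \/ x = v2].
Proof.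
rewrite dseq_enum => /perm_map_preim [[|v1 [|v2 r]] // rE [v1a v2b re]] e2.
exists v1, v2, r; split=> // x x2; have : x \in enum T by rewrite mem_enum.
rewrite (perm_mem rE) !inE => /or3P [/eqP|/eqP|xr]; [by left | by right |].
have /(allP e2) : deg G x \in e by rewrite -re map_f.
by rewrite leqNgt x2.
Qed.

Lemma house_on_top (T : finType) (G : sgraph T) a b c u w v1 v2 :
    house_at G a b c u w -> (forall x, 2 < deg G x -> x = v1 \/ x = v2) ->
  exists c' u' w', house_at G v1 v2 c' u' w'.
Proof.
move=> hs top; have [da db _ _ _] := house_degs hs.
have ab : a != b by case: hs => /= /andP []; rewrite inE negb_or => /andP [].
case: (top a da) (top b db) => [av|av] [bv|bv]; move: ab; rewrite av bv ?eqxx // => _.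
  by exists c, u, w; rewrite -av -bv.
by exists c, w, u; apply: house_atC; rewrite -av -bv.
Qed.

(** The two large vertices must carry the chord. Since [v1] is adjacent to everything, it also sees
    [w], which then has degree 3 and would be a third large vertex. *)
Lemma star_not_house (T : finType) (G : sgraph T) n k t m :
    perm_eq (dseq G (enum T)) ([:: n - 1; k] ++ nseq t 2 ++ nseq m 1) ->
    #|T| = n -> ~ contains K5_minus_P4 G.
Proof.
move=> dE Tn /contains_house_at [a [b [c [u [w hs]]]]].
have [|v1 [v2 [r [rE dv1 _ _ top]]]] := two_large dE.
  by rewrite all_cat !all_nseq !orbT.
have {a b c u w hs} [c [u [w hs]]] := house_on_top hs top.
have v1_dom y : y != v1 -> G v1 y.
  move=> yv; move: dv1; rewrite deg_count -Tn cardE (perm_size rE) (permP rE) /= adj_irr.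
  have := count_size (G v1) r; rewrite subn1 /=.
  have : y \in [:: v1, v2 & r] by rewrite -(perm_mem rE) mem_enum.
  rewrite !inE (negbTE yv) /=; case/orP => [/eqP -> |yr].
    by case: (G v1 v2) => //=; lia.
  move=> le eq; have : all (G v1) r.
    by rewrite all_count; case: (G v1 v2) eq => /=; lia.
  by move/allP; apply.
have wv : w != v1 /\ w != v2.
  by case: hs => U _ _ _ _ _ _; move: U; rewrite /= !inE !negb_or
    => /and5P [/and4P [_ _ _ h1] /and3P [_ _ h2] _ _ _]; rewrite ![w == _]eq_sym.
case: (top w (house_top_edges hs (v1_dom w wv.1))) => wE; move: wv; rewrite wE eqxx.
  by case.
by case.
Qed.

(** The two large degrees sum to [n + i], the others to [n + i - 2]. At least [n + i - 2] edges join
    the two groups, so none is left among the small vertices, where the house needs its side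
    [u w]. *)
Lemma book_not_house (T : finType) (G : sgraph T) n i k :
    perm_eq (dseq G (enum T)) ([:: n - k; k + i] ++ nseq i 2 ++ nseq (n - i - 2) 1) ->
    k <= n -> i + 2 <= n -> ~ contains K5_minus_P4 G.
Proof.
move=> dE kn i2n /contains_house_at [a [b [c [u [w hs]]]]].
have [|v1 [v2 [r [rE dv1 dv2 dr top]]]] := two_large dE.
  by rewrite all_cat !all_nseq !orbT.
have {a b c u w hs} [c [u [w hs]]] := house_on_top hs top.
have split_deg y : deg G y = G y v1 + (G y v2 + count (G y) r).
  by rewrite deg_count (permP rE).
have sumE r' : sumn (map (deg G) r') = count (G v1) r' + count (G v2) r' +
    sumn [seq count (G y) r | y <- r'].
  elim: r' => //= y r' ->; rewrite split_deg [G v1 y]adj_sym [G v2 y]adj_sym.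
  by move: (G y v1 : nat) (G y v2 : nat) (count (G y) r) => x1 x2 x3; arith.
have ur : uniq r by have := enum_uniq T; rewrite (perm_uniq rE) => /and3P [].
case: hs => /and5P [Uv1 Uv2 _ Uu _] _ _ _ _ _ uw.
have [u_r w_r] : u \in r /\ w \in r.
  have mem y : y != v1 -> y != v2 -> y \in r.
    have : y \in [:: v1, v2 & r] by rewrite -(perm_mem rE) mem_enum.
    by rewrite !inE => /or3P [-> //|->//|].
  move: Uv1 Uv2; rewrite !inE !negb_or => /and4P [_ _ uv1 wv1] /and3P [_ uv2 wv2].
  by split; apply: mem; rewrite eq_sym.
have inner : 2 <= sumn [seq count (G y) r | y <- r].
  have uwE : perm_eq r ([:: u; w] ++ [seq y <- r | y \notin [:: u; w]]).
    apply: perm_cat_sub => //; first by rewrite /= andbT.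
    by move=> y; rewrite !inE => /orP [] /eqP ->.
  rewrite (perm_sumn (perm_map _ uwE)) /= addnA.
  apply: leq_trans (leq_addr _ _); apply: (@leq_add 1 1); rewrite -has_count; apply/hasP.
    by exists w.
  by exists u; rewrite // adj_sym.
have := congr1 sumn dr; rewrite sumE sumn_cat !sumn_nseq.
move: dv1 dv2 inner; rewrite !split_deg !adj_irr [G v2 v1]adj_sym.
move: (count (G v1) r) (count (G v2) r) (sumn _) => x1 x2 x3.
by case: (G v1 v2); arith.
Qed.

(** The house exhausts the degrees of its five vertices, so the one or two vertices left would have
    to find degree 2 among themselves. *)
Lemma two_threes_not_house (T : finType) (G : sgraph T) n :
    perm_eq (dseq G (enum T)) (nseq 2 3 ++ nseq (n - 2) 2) ->
    n = 6 \/ n = 7 -> ~ contains K5_minus_P4 G.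
Proof.
move=> dE n67 /contains_house_at [a [b [c [u [w hs]]]]].
have [|v1 [v2 [r [rE dv1 dv2 dr top]]]] := two_large (e := nseq (n - 2) 2) dE.
  by rewrite all_nseq orbT.
have {a b c u w hs} [c [u [w hs]]] := house_on_top hs top.
have degr y : y \in r -> deg G y = 2.
  by move/(map_f (deg G)); rewrite dr mem_nseq => /andP [_ /eqP].
have [Uv1 Uv2 _ _ _] : and5 _ _ _ _ _ := and5P (house_uniq hs).
pose fs := [:: v1; v2; c; u; w].
pose out := [seq y <- enum T | y \notin fs].
have fsE : perm_eq (enum T) (fs ++ out).
  apply: perm_cat_sub; [exact: house_uniq hs | exact: enum_uniq | by move=> y; rewrite mem_enum].
have split_deg y : deg G y = count (G y) fs + count (G y) out.
  by rewrite deg_count (permP fsE) count_cat.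
have mem_r y : y != v1 -> y != v2 -> y \in r.
  have : y \in [:: v1, v2 & r] by rewrite -(perm_mem rE) mem_enum.
  by rewrite !inE => /or3P [-> //|->//|].
have [cr ur wr] : [/\ c \in r, u \in r & w \in r].
  move: Uv1 Uv2; rewrite !inE !negb_or => /and4P [_ cv1 uv1 wv1] /and3P [cv2 uv2 wv2].
  by split; apply: mem_r; rewrite eq_sym.
have tight y k : k <= count (G y) fs -> deg G y = k -> count (G y) out = 0.
  by rewrite split_deg; move: (count _ fs) (count _ out) => p q; arith.
have fs_out y : y \in fs -> count (G y) out = 0.
  have [h1 h2 h3 h4 h5] := house_counts hs.
  rewrite !inE => /orP [/eqP ->|/orP [/eqP ->|/or3P [] /eqP ->]].
  - exact: tight h1 dv1.
  - exact: tight h2 dv2.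
  - exact: tight h3 (degr c cr).
  - exact: tight h4 (degr u ur).
  - exact: tight h5 (degr w wr).
have szo : 0 < size out <= 2.
  have := perm_size dE; rewrite size_map (perm_size fsE) !size_cat !size_nseq.
  by move: (size out) => k; case: n67 => -> /=; arith.
have [z zo] : exists z, z \in out by case: (out) szo => // z o _; exists z; rewrite mem_head.
have zfs : z \notin fs by move: zo; rewrite mem_filter => /andP [].
have : 2 <= deg G z.
  by rewrite degr //; apply: mem_r; apply: contraNneq zfs => ->; rewrite !inE eqxx ?orbT.
rewrite split_deg (_ : count (G z) fs = 0); last first.
  apply/eqP; rewrite -leqn0 leqNgt -has_count; apply/hasPn => y yfs; rewrite adj_sym.
  have /eqP := fs_out y yfs; rewrite -leqn0 leqNgt -has_count => /hasPn; exact.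
move: szo; rewrite (perm_size (perm_to_rem zo)) (permP (perm_to_rem zo)) /= adj_irr.
by have := count_size (G z) (rem z out); move: (count _ _) (size _) => p q; arith.
Qed.

(** * Assembly of both directions *)

Lemma house_free_exceptional (T : finType) (G : sgraph T) d n :
    perm_eq (dseq G (enum T)) d -> sorted geq d -> size d = n ->
    1 <= nth 0 d (n - 1) -> 3 <= nth 0 d 1 -> 2 <= nth 0 d 4 -> house_free G ->
  [\/ star_type n d, book_type n d | small_exception d].
Proof.
move=> dE sd szd pos d2 d5 hG.
have n0 : 0 < n by rewrite -szd; case: (d) d2.
have cE k : count (fun y => k < count (G y) (enum T)) (enum T) = count (leq k.+1) d.
  by rewrite -(permP dE) [RHS]count_map.
have rG : rich G (enum T).
  split; last by rewrite cE -sorted_nth_count.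
  - rewrite all_count cE -(size_map (fun y => count (G y) (enum T))) (perm_size dE) szd.
    move: pos; rewrite sorted_nth_count // => pos.
    by rewrite eqn_leq -{1}szd count_size; move: pos; rewrite subn1 prednK.
  - by rewrite cE -sorted_nth_count.
have szT : size (enum T) = n.
  by rewrite -szd -(perm_size dE) [RHS]size_map.
case: (find_core hG (enum_uniq T) rG) => [core|[] sE].
- have [[k [t [h1 h2 h3 h4]]]|[i [k [h1 h2 h3]]]] := has_core_type hG (enum_uniq T) rG core.
    by constructor 1; rewrite szT in h1 h2 h4; exists k, t; rewrite -(permPl dE).
  by constructor 2; rewrite szT in h1 h2 h3; exists i, k; rewrite -(permPl dE).
- by constructor 3; left; rewrite -(permPl dE).
- by constructor 3; right; rewrite -(permPl dE).
Qed.

Theorem theorem2p1 (n : nat) (d : seq nat)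
    (hn : 5 <= n) (hsize : size d = n) (hgraphic : graphic d)
    (hnonincr : sorted geq d) (hpos : 1 <= nth 0 d (n - 1)) :
  potentially K5_minus_P4 d <->
  [/\ (* d is indexed from 0: d_2 and d_5 are nth 0 d 1 and nth 0 d 4 *)
      3 <= nth 0 d 1,
      2 <= nth 0 d 4,
      forall k t : nat, 3 <= k <= n - 2 -> 3 <= t <= n - 2 -> odd k != odd t ->
        d <> [:: n - 1; k] ++ nseq t 2 ++ nseq (n - 2 - t) 1,
      forall i k : nat, 1 <= k <= (n - 1) %/ 2 - 1 -> 3 <= i <= n - 2 * k ->
        d <> [:: n - k; k + i] ++ nseq i 2 ++ nseq (n - i - 2) 1
    & n = 6 \/ n = 7 -> d <> nseq 2 3 ++ nseq (n - 2) 2].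
Proof.
split=> [[T [G [/perm_realization dE hG]]]|[d2 d5 not_star not_book not_small]].
  have Tn : #|T| = n by rewrite cardT -hsize -(perm_size dE) [RHS]size_map.
  have [a [b [c [u [w hs]]]]] := contains_house_at hG.
  have [da db dc du dw] := house_degs hs; have U := house_uniq hs.
  rewrite dseq_enum in dE.
  split.
  - rewrite sorted_nth_count // -(permP dE) count_map.
    apply: (@leq_size_count _ _ [:: a; b]); last by rewrite /= da db.
    by move: U => /= /andP []; rewrite !inE negb_or => /andP [->].
  - rewrite sorted_nth_count // -(permP dE) count_map.
    by apply: (leq_size_count U); rewrite /= dc du dw (ltnW da) (ltnW db).
  - by move=> k t _ _ _ dd; rewrite dd -dseq_enum in dE; apply: star_not_house dE Tn hG.
  - move=> i k k_le i_le dd; rewrite dd -dseq_enum in dE.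
    by apply: (book_not_house dE _ _ hG); lia.
  - by move=> n67 dd; rewrite dd -dseq_enum in dE; apply: two_threes_not_house dE n67 hG.
(* By contradiction: if no realization of [d] contains a house, the given one is [house_free]. *)
apply: NNPP => not_pot; case: hgraphic => T [G /perm_realization dE].
have hG : house_free G.
  move=> hh; apply: not_pot; apply: has_house_potentially => //.
  exact: has_house_perm dE hh.
case: (house_free_exceptional dE hnonincr hsize hpos d2 d5 hG).
- move=> [k [t [kn tn kt dE']]]; apply: (not_star k t kn tn kt).
  by apply: sorted_perm_eq => //; apply: sorted_two_steps; lia.
- move=> [i [k [kn i_n dE']]]; apply: (not_book i k kn i_n).
  by apply: sorted_perm_eq => //; apply: sorted_two_steps; lia.
(* The length of the exceptional sequence forces [n] to be 6 or 7. *)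
by case=> dE'; have nE := perm_size dE'; rewrite hsize /= in nE; apply: not_small;
  rewrite nE; [left | apply: sorted_perm_eq | right | apply: sorted_perm_eq].
Qed.
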